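(* Let $P(u)=\frac{p_{-1}}{u}+p_0+p_1u$ be the step polynomial of weighted Motzkin walks. Let $X_n$ denote the number of sign changes of a random Motzkin walk of length $n$. Let $\delta=P'(1)$ be the drift. 1. For $\delta\neq0$ one gets convergence (as $n\to\infty$) to a geometric distribution: $$X_n\stackrel{d}{\to}\operatorname{Geom}(\lambda),\qquad\text{with}\quad \lambda=\begin{cases}\dfrac{p_1}{p_{-1}},&\text{for }\delta<0,\\[2mm] \dfrac{p_{-1}}{p_1},&\text{for }\delta>0.\end{cases}$$ 2. For $\delta=0$ one gets convergence to a half-normal distribution: $$\frac{X_n}{\sqrt n}\stackrel{d}{\to}\mathcal{H}\left(\frac12\sqrt{\frac{P''(1)}{P(1)}}\right).$$
   Context: A (weighted) Motzkin walk of length $n$ is a sequence of $n$ steps from $\{-1,0,1\}$, identified with its altitudes $(\omega_0,\dots,\omega_n)$, $\omega_0=0$, $\omega_i-\omega_{i-1}\in\{-1,0,1\}$. The steps $-1,0,1$ have weights $p_{-1},p_0,p_1>0$; the weight of a walk is the product of the weights of its steps, and a random Motzkin walk of length $n$ is chosen with probability proportional to its weight. Nodes strictly above the $x$-axis ($\omega_i>0$) have positive sign ''$+$'', nodes strictly below ($\omega_i<0$) have negative sign ''$-$'', and nodes on the $x$-axis ($\omega_i=0$) are neutral, ''$0$''. A walk thus gives a sequence of signs; a sign change is an occurrence in this sequence of the pattern $+(0)-$ or $-(0)+$, where $(0)$ denotes a non-empty sequence of zeros. Here $\operatorname{Geom}(\lambda)$ is the distribution on $\{0,1,2,\dots\}$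 with $\mathbb{P}(X=k)=(1-\lambda)\lambda^k$. $\mathcal{H}(\sigma)$ is the half-normal distribution with density $\sqrt{\frac{2}{\pi\sigma^2}}\exp\left(-\frac{x^2}{2\sigma^2}\right)$, $x\ge0$. *)

(* Defs.v *)
From HB Require Import structures.
From mathcomp Require Import all_boot all_order all_algebra.
From mathcomp Require Import all_classical all_reals all_analysis.
From mathcomp Require Import measurable_realfun.

Set Implicit Arguments.
Unset Strict Implicit.
Unset Printing Implicit Defensive.

Import Order.TTheory GRing.Theory Num.Theory.
Import numFieldNormedType.Exports.

Local Open Scope classical_set_scope.
Local Open Scope ring_scope.

Definition motzkin_step := seq_sub [:: -1; 0; 1 : int].

HB.instance Definition _ := Finite.on motzkin_step.

Lemma motzkin_step0_subproof : (0 : int) \in [:: -1; 0; 1 : int].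
Proof. by []. Qed.

Definition motzkin_step0 : motzkin_step := SeqSub motzkin_step0_subproof.

Definition motzkin_walk (n : nat) := n.-tuple motzkin_step.

HB.instance Definition _ n := Finite.on (motzkin_walk n).
HB.instance Definition _ n :=
  isPointed.Build (motzkin_walk n) [tuple of nseq n motzkin_step0].
HB.instance Definition _ n := @isMeasurable.Build default_measure_display
  (motzkin_walk n) discrete_measurable discrete_measurable0
  discrete_measurableC discrete_measurableU.

Definition altitude n (w : motzkin_walk n) (i : nat) : int :=
  \sum_(s <- take i w) ssval s.

Definition node_sign n (w : motzkin_walk n) (i : nat) : int :=
  sgz (altitude w i).

(* A sign change is identified with the pair of positions (i, j) of the two
   nonzero signs delimiting the pattern; [i.+1 < j] says that the block of
   zeros between them is nonempty. *)
Definition is_sign_change n (w : motzkin_walk n) (ij : 'I_n.+1 * 'I_n.+1) :=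
  [&& (ij.1.+1 < ij.2)%N,
      [forall k : 'I_n.+1,
        (ij.1 < k < ij.2)%N ==> (node_sign w k == 0)] &
      [&& node_sign w ij.1 == 1 & node_sign w ij.2 == -1] ||
      [&& node_sign w ij.1 == -1 & node_sign w ij.2 == 1]].

Definition nb_sign_changes n (w : motzkin_walk n) : nat :=
  #|[set ij | is_sign_change w ij]%SET|.

Section motzkin_probability.
Context {R : realType}.
Variables (pm1 p0 p1 : {posnum R}).

Definition step_weight (s : motzkin_step) : R :=
  if ssval s == -1 then pm1%:num else
  if ssval s == 0 then p0%:num else p1%:num.

Definition walk_weight n (w : motzkin_walk n) : R :=
  \prod_(s <- w) step_weight s.

Definition motzkin_prob n (A : set (motzkin_walk n)) : \bar R :=
  ((\sum_(w : motzkin_walk n | w \in A) walk_weight w) /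
   (\sum_(w : motzkin_walk n) walk_weight w))%:E.

Lemma step_weight_gt0 s : 0 < step_weight s.
Proof. by rewrite /step_weight; case: ifP => // _; case: ifP. Qed.

Lemma walk_weight_gt0 n (w : motzkin_walk n) : 0 < walk_weight w.
Proof. by apply: prodr_gt0 => s _; exact: step_weight_gt0. Qed.

Lemma sum_walk_weight_gt0 n : 0 < \sum_(w : motzkin_walk n) walk_weight w.
Proof.
rewrite (bigD1 [tuple of nseq n motzkin_step0])//=.
rewrite ltr_pwDl ?walk_weight_gt0//.
by apply: sumr_ge0 => w _; rewrite ltW// walk_weight_gt0.
Qed.

Section motzkin_prob_instance.
Variable n : nat.
Local Notation motzkin_prob := (@motzkin_prob n).

Let motzkin_prob0 : motzkin_prob set0 = 0%E.
Proof. by rewrite /motzkin_prob big1 ?mul0r// => w; rewrite in_set0. Qed.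

Let motzkin_prob_ge0 A : (0 <= motzkin_prob A)%E.
Proof.
rewrite lee_fin divr_ge0 ?(ltW (sum_walk_weight_gt0 n))//.
by apply: sumr_ge0 => w _; rewrite ltW// walk_weight_gt0.
Qed.

Let motzkin_probE A : motzkin_prob A = (\sum_(w : motzkin_walk n)
  (walk_weight w / \sum_(v : motzkin_walk n) walk_weight v)%:E * \d_w A)%E.
Proof.
rewrite /motzkin_prob mulr_suml -sumEFin big_mkcond/=.
apply: eq_bigr => w _; rewrite diracE.
by case: (w \in A); rewrite ?mule1 ?mule0.
Qed.

Let motzkin_prob_sigma_additive : semi_sigma_additive motzkin_prob.
Proof.
move=> F mF tF mUF; rewrite motzkin_probE.
have -> : (fun k => \sum_(0 <= i < k) motzkin_prob (F i))%E =
  (fun k => \sum_(w : motzkin_walk n)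
    (walk_weight w / \sum_(v : motzkin_walk n) walk_weight v)%:E *
      \sum_(0 <= i < k) \d_w (F i))%E.
  apply/funext => k; under eq_bigr do rewrite motzkin_probE.
  rewrite exchange_big/=; apply: eq_bigr => w _.
  by rewrite ge0_sume_distrr.
apply: cvg_nnesum => w _.
  apply: nearW => k; apply: mule_ge0.
    by rewrite lee_fin divr_ge0 ?ltW ?walk_weight_gt0 ?sum_walk_weight_gt0.
  exact: sume_ge0.
by apply: cvgeZl => //; exact: measure_semi_sigma_additive.
Qed.

HB.instance Definition _ := isMeasure.Build _ _ _ motzkin_prob
  motzkin_prob0 motzkin_prob_ge0 motzkin_prob_sigma_additive.

Let motzkin_prob_setT : motzkin_prob [set: _] = 1%E.
Proof.
rewrite /motzkin_prob (eq_bigl xpredT) => [|w]; last by rewrite in_setT.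
by rewrite divff// gt_eqF// sum_walk_weight_gt0.
Qed.

HB.instance Definition _ :=
  @Measure_isProbability.Build _ _ R motzkin_prob motzkin_prob_setT.

End motzkin_prob_instance.

End motzkin_probability.

Arguments motzkin_prob {R} pm1 p0 p1 n A.

Section sign_changes_rv.
Context {R : realType} (n : nat).

Definition sign_changes (w : motzkin_walk n) : R := (nb_sign_changes w)%:R.

Let measurable_sign_changes : measurable_fun [set: motzkin_walk n] sign_changes.
Proof. by []. Qed.

HB.instance Definition _ := isMeasurableFun.Build _ _ _ _ sign_changes
  measurable_sign_changes.

(* For n = 0 this is the zero function, as 0^-1 = 0. *)
Definition scaled_sign_changes (w : motzkin_walk n) : R :=
  sign_changes w / Num.sqrt n%:R.

Let measurable_scaled_sign_changes :
  measurable_fun [set: motzkin_walk n] scaled_sign_changes.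
Proof. by []. Qed.

HB.instance Definition _ := isMeasurableFun.Build _ _ _ _ scaled_sign_changes
  measurable_scaled_sign_changes.

End sign_changes_rv.

Arguments sign_changes R n w : clear implicits.
Arguments scaled_sign_changes R n w : clear implicits.

Definition step_polynomial {R : realType} (pm1 p0 p1 : R) (u : R) : R :=
  pm1 / u + p0 + p1 * u.

Definition cvg_in_distribution {R : realType} d (T : nat -> measurableType d)
    (P : forall n, probability (T n) R) (X : forall n, {RV (P n) >-> R})
    (mu : probability R R) :=
  let F (x : R) := mu `]-oo, x]%classic in
  forall x : R, {for x, continuous F} -> cdf (X n) x @[n --> \oo] --> F x.

Arguments cvg_in_distribution {R d T} P X mu.

Section geometric_distribution.
Context {R : realType}.

(* The Dirac mass at 0 is a default value for parameters out of [0, 1[. *)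
Definition geometric_prob (l : R) (U : set nat) : \bar R :=
  if 0 <= l < 1 then \esum_(k in U) ((1 - l) * l ^+ k)%:E else \d_0%N U.

Section geometric_instance.
Variable l : R.
Local Open Scope ereal_scope.
Local Notation geom := (geometric_prob l).

Let pmf_ge0 k : (0 <= l < 1)%R -> 0 <= ((1 - l) * l ^+ k)%:E :> \bar R.
Proof.
by move=> /andP[l0 l1]; rewrite lee_fin mulr_ge0 ?exprn_ge0// subr_ge0 ltW.
Qed.

Let geom0 : geom set0 = 0.
Proof.
by rewrite /geometric_prob measure0; case: ifPn => //; rewrite esum_set0.
Qed.

Let geom_ge0 U : 0 <= geom U.
Proof.
rewrite /geometric_prob; case: ifPn => // l01; apply: esum_ge0 => k _.
exact: pmf_ge0.
Qed.

Let geom_sigma_additive : semi_sigma_additive geom.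
Proof.
move=> F mF tF mUF; rewrite /geometric_prob; case: ifPn => l01; last first.
  exact: measure_semi_sigma_additive.
apply: cvg_toP.
  apply: ereal_nondecreasing_is_cvgn => a b ab.
  apply: lee_sum_nneg_natr => // n _ _.
  by apply: esum_ge0 => k _; exact: pmf_ge0.
by rewrite nneseries_sum_bigcup// => i; exact: pmf_ge0.
Qed.

HB.instance Definition _ := isMeasure.Build _ _ _ geom
  geom0 geom_ge0 geom_sigma_additive.

Let geom_setT : geom [set: nat] = 1.
Proof.
rewrite /geometric_prob; case: ifPn => [l01|_]; last first.
  by rewrite probability_setT.
have /andP[l0 l1] := l01.
rewrite -nneseries_esumT; last by move=> *; exact: pmf_ge0.
apply/cvg_lim => //.
have -> : (fun n => \sum_(0 <= k < n) ((1 - l) * l ^+ k)%:E) =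
    EFin \o series (geometric (1 - l)%R l).
  by apply/funext => n /=; rewrite sumEFin.
apply: cvg_EFin; first exact: nearW.
have := @cvg_geometric_series R (1 - l)%R l.
by rewrite ger0_norm// => /(_ l1); rewrite divff// subr_eq0 gt_eqF.
Qed.

HB.instance Definition _ :=
  @Measure_isProbability.Build _ _ R geom geom_setT.

End geometric_instance.

Definition nat_to_real (k : nat) : R := k%:R.

Let measurable_nat_to_real : measurable_fun [set: nat] nat_to_real.
Proof. by []. Qed.

HB.instance Definition _ := isMeasurableFun.Build _ _ _ _ nat_to_real
  measurable_nat_to_real.

Definition Geom (l : R) : probability R R :=
  distribution (geometric_prob l) nat_to_real.

End geometric_distribution.

Section half_normal_distribution.
Context {R : realType}.
Local Notation mu := lebesgue_measure.

Definition half_normal_pdf (s x : R) : R :=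
  if 0 <= x then
    Num.sqrt (2 / (pi * s ^+ 2)) * expR (- (x ^+ 2 / (2 * s ^+ 2)))
  else 0.

(* The Dirac mass at 0 is a default value for nonpositive parameters. *)
Definition half_normal_prob (s : R) (A : set R) : \bar R :=
  if 0 < s then (\int[mu]_(x in A) (half_normal_pdf s x)%:E)%E
  else \d_(0 : R) A.

Lemma half_normal_pdf_ge0 (s x : R) : 0 <= half_normal_pdf s x.
Proof.
by rewrite /half_normal_pdf; case: ifP => // _; rewrite mulr_ge0 ?expR_ge0.
Qed.

Let half_normal_pdfE (s : R) : 0 < s ->
  half_normal_pdf s = (fun x => 2 * normal_pdf 0 s x) \_ `[0, +oo[.
Proof.
move=> s0; apply/funext => x; rewrite patchE /half_normal_pdf.
rewrite mem_setE in_itv/= andbT; case: ifPn => // x0.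
rewrite normal_pdfE ?gt_eqF// /normal_peak /normal_fun subr0 [RHS]mulrA.
rewrite mulNr [in LHS](mulr_natl (s ^+ 2)); congr (_ * _).
have pis0 : 0 <= s ^+ 2 * pi *+ 2.
  by rewrite mulrn_wge0// mulr_ge0 ?sqr_ge0 ?pi_ge0.
rewrite -sqrtrV// -[X in _ = X * _](@ger0_norm R 2)//.
rewrite -sqrtr_sqr -sqrtrM ?sqr_ge0//.
congr Num.sqrt; rewrite -(mulr_natl (s ^+ 2 * pi)) (mulrC pi) [in RHS]invfM.
by rewrite [RHS]mulrA expr2 mulfK.
Qed.

Let measurable_half_normal_pdf (s : R) : 0 < s ->
  measurable_fun [set: R] (half_normal_pdf s).
Proof.
move=> s0; rewrite half_normal_pdfE//.
apply/(measurable_restrictT _ _).1 => //.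
apply: measurable_funTS; apply: measurable_funM => //.
exact: measurable_normal_pdf.
Qed.

Section half_normal_instance.
Variable s : R.
Local Open Scope ereal_scope.
Local Notation hn := (half_normal_prob s).

Let hn0 : hn set0 = 0.
Proof. by rewrite /half_normal_prob measure0 integral_set0; case: ifP. Qed.

Let hn_ge0 A : 0 <= hn A.
Proof.
rewrite /half_normal_prob; case: ifP => // _; apply: integral_ge0 => x _.
by rewrite lee_fin half_normal_pdf_ge0.
Qed.

Let hn_sigma_additive : semi_sigma_additive hn.
Proof.
move=> F mF tF mUF; rewrite /half_normal_prob; case: ifPn => s0; last first.
  exact: measure_semi_sigma_additive.
rewrite ge0_integral_bigcup//=.
- apply: is_cvg_ereal_nneg_natsum_cond => n _ _.
  by apply: integral_ge0 => x _; rewrite lee_fin half_normal_pdf_ge0.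
- by apply: measurable_funTS; apply/measurable_EFinP;
    exact: measurable_half_normal_pdf.
- by move=> x _; rewrite lee_fin half_normal_pdf_ge0.
Qed.

HB.instance Definition _ := isMeasure.Build _ _ _ hn
  hn0 hn_ge0 hn_sigma_additive.

Let hn_setT : hn [set: _] = 1.
Proof.
rewrite /half_normal_prob; case: ifPn => s0; last by rewrite probability_setT.
have s_neq0 : s != 0%R by rewrite gt_eqF.
rewrite half_normal_pdfE//.
have -> : (fun x => (((fun x => 2 * normal_pdf 0 s x)%R \_ `[0%R, +oo[) x)%:E)
    = ((fun x => (2 * normal_pdf 0 s x)%:E) \_ `[0%R, +oo[) :> (R -> \bar R).
  by apply/funext => x; rewrite !patchE; case: ifP.
rewrite -integral_mkcond.
under eq_integral do rewrite EFinM.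
rewrite ge0_integralZl//; last 2 first.
- by apply: measurable_funTS; apply/measurable_EFinP;
    exact: measurable_normal_pdf.
- by move=> x _; rewrite lee_fin normal_pdf_ge0.
rewrite -(@integral_normal_pdf R 0 s).
rewrite (@ge0_symfun_integralT _ (normal_pdf 0 s))//.
- congr (_ * _); congr integral; apply/seteqP; split => x /=;
    by rewrite in_itv/= andbT.
- by move=> x; exact: normal_pdf_ge0.
- exact: continuous_normal_pdf.
- by move=> x; rewrite /= !normal_pdfE// /normal_fun !subr0 sqrrN.
Qed.

HB.instance Definition _ :=
  @Measure_isProbability.Build _ _ R hn hn_setT.

End half_normal_instance.

Definition HalfNormal (s : R) : probability R R :=
  half_normal_prob s.

End half_normal_distribution.

(* Main.v *)
Require Import Defs.
From HB Require Import structures.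
From mathcomp Require Import all_boot all_order all_algebra.
From mathcomp Require Import all_classical all_reals all_analysis.
From mathcomp Require Import measurable_realfun.
From mathcomp Require Import zify ring lra.
Import Order.TTheory GRing.Theory Num.Theory.
Import numFieldNormedType.Exports.
Local Open Scope classical_set_scope.
Local Open Scope ring_scope.

(** The number of sign changes is governed by first passages. Normalise the
    step weights to probabilities [qm], [q0], [qp] and put [rho = qp / qm].
    An excursion from 0 above the axis and its mirror image below contain as
    many up steps as down steps, hence have the same weight: given that the
    walk makes an excursion, its sign is a fair coin. Consequently a sign
    change costs as much as going two levels further down, and the
    probability of at least [k] sign changes is explicit:
    - from altitude [m >= 0] with last nonzero sign [+], it is a power of [rho]
      times the probability that a walk started at 0 visits the level
      [- (m + 2k - 1)], and similarly below the axis with last sign [-] ([tail_prob_signed]);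
    - from the start, where no sign has been seen yet, it is the average with
      weights [q0] and [1 - q0] that waits for the first nonzero step
      ([tail_prob_start]), of [rho ^+ k] times the probability [hit] that a
      walk started at 0 visits [- 2k].
    Both sides of such an identity obey the same one-step recursion, so
    induction on the length proves it.

    If the drift is negative, the walk visits every negative level, [hit]
    tends to 1, and the tail tends to [rho ^+ k]: the geometric law. If the
    drift is positive, [hit_swap] exchanges up and down steps, which replaces
    [rho] by its inverse.

    Without drift, [rho = 1], and [hit n (2k)] with [k] of order [sqrt n] is to be
    compared with its Brownian analogue [2 (1 - Phi (2k / sqrt (4 n)))], where
    [Phi] is the distribution function of the centred normal law of standard
    deviation [s], [s ^+ 2 = qp / 2]. The function
    [y, t |-> Phi (y / sqrt t)] solves a heat equation, hence satisfies the
    recursion of [hit] up to an error of order [t ^ (-3/2)] ([heat_step]).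
    Started at a small positive time and shifted by a distance that is large
    for this time, but small compared with [sqrt n], it gives functions above
    and below [hit] ([hit_barriers], [average_barriers]), by a discrete
    maximum principle; being monotone, they also enclose the average that the
    start of the walk requires. Both barriers have the half-normal tail as
    their limit ([critical_average_cvg]). *)

(** * Counting sign changes step by step *)

Fixpoint last_sign (sg : nat -> int) (j : nat) : int :=
  if j is i.+1 then (if sg i == 0 then last_sign sg i else sg i) else 0.

Definition zeros_between (sg : nat -> int) (i j : nat) : bool :=
  all (fun k => sg k == 0) (index_iota i.+1 j).

Lemma zeros_betweenS (sg : nat -> int) (i j : nat) : (i < j)%N ->
  zeros_between sg i j.+1 = zeros_between sg i j && (sg j == 0).
Proof.
move=> ij; rewrite /zeros_between /index_iota subSS.
have -> : (j - i = (j - i.+1).+1)%N by lia.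
rewrite -[(_ - _).+1]addn1 iotaD all_cat /= andbT.
by congr (_ && (sg _ == 0)); lia.
Qed.

Lemma zeros_between_adjacent (sg : nat -> int) (j : nat) :
  zeros_between sg j j.+1.
Proof. by rewrite /zeros_between /index_iota subnn. Qed.

(** At most one [i] contributes: only the last nonzero position before [j]
    sees nothing but zeros between itself and [j]. *)
Lemma sum_last_sign (sg : nat -> int) (v : int) (j : nat) : v != 0 ->
  (\sum_(i < j) (zeros_between sg i j && (sg i == v)) = (last_sign sg j == v))%N.
Proof.
move=> v0; elim: j => [|j IH]; first by rewrite big_ord0 eq_sym (negbTE v0).
rewrite big_ord_recr /= zeros_between_adjacent /=.
under eq_bigr => i _ do rewrite zeros_betweenS ?ltn_ord //.
case: ifPn => sj.
  rewrite (eqP sj) [0 == v]eq_sym (negbTE v0) addn0 -IH.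
  by apply: eq_bigr => i _; rewrite andbT.
by rewrite big1 // => i _; rewrite andbF.
Qed.

(** For sign changes to be counted step by step, all that a walk has to
    remember of its past is its altitude and the last nonzero sign. *)
Definition advance (st : int * int) (s : motzkin_step) : int * int :=
  let y := st.1 + ssval s in (y, if y == 0 then st.2 else sgz y).

Definition flips (st : int * int) (s : motzkin_step) : bool :=
  let y := st.1 + ssval s in (y != 0) && (st.2 == - sgz y).

Fixpoint changes (st : int * int) (w : seq motzkin_step) : nat :=
  if w is s :: w' then (flips st s + changes (advance st s) w')%N else 0%N.

Lemma changes_rcons (st : int * int) (w : seq motzkin_step) (s : motzkin_step) :
  changes st (rcons w s) = (changes st w + flips (foldl advance st w) s)%N.
Proof.
elim: w st => [|t w IH] st /=; first by rewrite addn0.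
by rewrite IH addnA.
Qed.

Lemma motzkin_step_cases (s : motzkin_step) :
  [\/ ssval s = -1, ssval s = 0 | ssval s = 1].
Proof.
case: s => s /= ; rewrite !inE => /or3P[] /eqP ->; [exact: Or31|exact: Or32|exact: Or33].
Qed.

Section walk.
Variables (n : nat) (w : motzkin_walk n).

Let state (m : nat) := foldl advance (0, 0) (take m w).

Lemma altitude0 : altitude w 0 = 0.
Proof. by rewrite /altitude take0 big_nil. Qed.

Lemma altitudeS (m : nat) : (m < n)%N ->
  altitude w m.+1 = altitude w m + ssval (nth motzkin_step0 w m).
Proof.
move=> mn; rewrite /altitude (take_nth motzkin_step0) ?size_tuple //.
by rewrite -cats1 big_cat big_seq1.
Qed.

Lemma stateS (m : nat) : (m < n)%N ->
  state m.+1 = advance (state m) (nth motzkin_step0 w m).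
Proof.
by move=> mn; rewrite /state (take_nth motzkin_step0) ?size_tuple // foldl_rcons.
Qed.

Lemma stateE (m : nat) : (m <= n)%N ->
  state m = (altitude w m, last_sign (node_sign w) m.+1).
Proof.
elim: m => [_|m IH mn].
  by rewrite /state take0 /= /node_sign altitude0 sgz0.
rewrite stateS // IH 1?ltnW // /advance -altitudeS //=.
by rewrite /node_sign !sgz_eq0.
Qed.

(** Steps have size at most 1, so opposite signs are never adjacent. This is
    why the condition that the block of zeros be nonempty holds by itself. *)
Lemma node_sign_adjacent (m : nat) : (m < n)%N -> node_sign w m.+1 != 0 ->
  node_sign w m != - node_sign w m.+1.
Proof.
rewrite /node_sign => mn; rewrite altitudeS //.
case: (motzkin_step_cases (nth motzkin_step0 w m)) => ->;
  rewrite -sgzN; case: sgzP => //; case: sgzP => //; lia.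
Qed.

Lemma is_sign_changeE (i j : 'I_n.+1) : is_sign_change w (i, j) =
  [&& (i < j)%N, zeros_between (node_sign w) i j, node_sign w j != 0 &
      node_sign w i == - node_sign w j].
Proof.
rewrite /is_sign_change /=.
have -> : [forall k : 'I_n.+1, (i < k < j)%N ==> (node_sign w k == 0)] =
    zeros_between (node_sign w) i j.
  apply/forallP/allP => [H k|H k].
    rewrite mem_index_iota => kij.
    have kn : (k < n.+1)%N by have := ltn_ord j; lia.
    by move: (H (Ordinal kn)) => /=; rewrite kij.
  by apply/implyP => kij; apply: H; rewrite mem_index_iota.
have -> : [&& node_sign w i == 1 & node_sign w j == -1] ||
    [&& node_sign w i == -1 & node_sign w j == 1] =
    (node_sign w j != 0) && (node_sign w i == - node_sign w j).
  by rewrite /node_sign; case: sgzP => _; case: sgzP.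
case: (ltnP i j) => ij; last by rewrite ltnNge (leq_trans ij).
case: (ltnP i.+1 j) => ij' //=.
have /eqP jE : (j == i.+1 :> nat) by rewrite eqn_leq ij' ij.
symmetry; apply/and3P => -[_ h /negPn]; apply/negP.
by move: h; rewrite jE negbK => /node_sign_adjacent -> //; have := ltn_ord j; lia.
Qed.

Lemma sum_sign_changes (m : nat) : (m <= n)%N ->
  (\sum_(j < m.+1) \sum_(i < j) [&& zeros_between (node_sign w) i j,
      node_sign w j != 0 & node_sign w i == - node_sign w j])%N =
  changes (0, 0) (take m w).
Proof.
elim: m => [_|m IH mn]; first by rewrite big_ord_recr !big_ord0 take0.
rewrite big_ord_recr /= IH 1?ltnW // (take_nth motzkin_step0) ?size_tuple //.
rewrite changes_rcons; congr (_ + _)%N.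
rewrite -/(state m) stateE 1?ltnW // /flips -altitudeS // -[altitude _ _ == 0]sgz_eq0.
rewrite -[sgz _]/(node_sign w m.+1).
have [->|j0] := eqVneq (node_sign w m.+1) 0.
  by rewrite big1 // => i _; rewrite andbF.
by rewrite -[RHS]/(nat_of_bool (_ == _)) -sum_last_sign ?oppr_eq0.
Qed.

(** Sorting the pairs by their right end turns the cardinality into a count
    that can be read off while the walk advances, and that can be unrolled from
    the first step. *)
Lemma nb_sign_changesE : nb_sign_changes w = changes (0, 0) w.
Proof.
rewrite -[in RHS](@take_oversize _ n w) ?size_tuple // -sum_sign_changes //.
rewrite /nb_sign_changes cardsE -sum1_card.
rewrite (eq_bigl (is_sign_change w)) // big_mkcond /=.
rewrite -(pair_bigA _ (fun i j => if is_sign_change w (i, j) then 1 else 0))%N.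
rewrite exchange_big; apply: eq_bigr => j _ /=.
rewrite (big_ord_widen n.+1 (fun i => nat_of_bool [&& zeros_between (node_sign w) i j,
   node_sign w j != 0 & node_sign w i == - node_sign w j])); last first.
  by have := ltn_ord j; lia.
rewrite [RHS]big_mkcond; apply: eq_bigr => i _; rewrite is_sign_changeE.
by case: ltnP => //= _; case: ifP => [->|->].
Qed.

End walk.

(** * The tail of the count as a first passage probability *)

Lemma down_step_subproof : (-1 : int) \in [:: -1; 0; 1 : int]. Proof. by []. Qed.
Lemma up_step_subproof : (1 : int) \in [:: -1; 0; 1 : int]. Proof. by []. Qed.
Definition down_step : motzkin_step := SeqSub down_step_subproof.
Definition up_step : motzkin_step := SeqSub up_step_subproof.

Lemma sum_motzkin_step (R : nmodType) (F : motzkin_step -> R) :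
  \sum_(s : motzkin_step) F s = F down_step + F motzkin_step0 + F up_step.
Proof.
rewrite (bigD1 down_step) //= (bigD1 motzkin_step0) //= (bigD1 up_step) //=.
rewrite big1 ?addr0 ?addrA // => s.
by case: (motzkin_step_cases s) => sE; rewrite -!val_eqE /= sE.
Qed.

Lemma sum_tuple_cons (R : nmodType) (T : finType) (n : nat) (F : seq T -> R) :
  \sum_(w : n.+1.-tuple T) F w = \sum_(s : T) \sum_(w : n.-tuple T) F (s :: w).
Proof.
rewrite pair_bigA /= (reindex (fun p : T * n.-tuple T => cons_tuple p.1 p.2)) //.
exists (fun w => (thead w, behead_tuple w)) => [[s w] _|w _] /=.
  by congr (_, _); apply: val_inj.
by rewrite [RHS]tuple_eta.
Qed.

Section hit.
Context {R : pzRingType}.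

(** The first passage probability to the level [- y] within [n] steps, as a
    function of the distance [y] still to be covered. *)
Fixpoint hit (qm q0 qp : R) (n y : nat) : R :=
  match y, n with
  | 0%N, _ => 1
  | y'.+1, 0%N => 0
  | y'.+1, n'.+1 =>
      qm * hit qm q0 qp n' y' + q0 * hit qm q0 qp n' y'.+1 +
      qp * hit qm q0 qp n' y'.+2
  end.

Lemma hit0 (qm q0 qp : R) (n : nat) : hit qm q0 qp n 0 = 1.
Proof. by case: n. Qed.

End hit.

Section tail.
Context {R : realType}.
Variables (pm1 p0 p1 : {posnum R}).

Definition total_weight : R := pm1%:num + p0%:num + p1%:num.

Local Notation Z := total_weight.
Local Notation qm := (pm1%:num / Z).
Local Notation q0 := (p0%:num / Z).
Local Notation qp := (p1%:num / Z).
Local Notation rho := (p1%:num / pm1%:num).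

Lemma total_weight_gt0 : 0 < Z.
Proof. by rewrite /total_weight !addr_gt0. Qed.

Lemma sum_step_prob : qm + q0 + qp = 1.
Proof. by rewrite -!mulrDl divff // gt_eqF // total_weight_gt0. Qed.

(** Dividing by [Z ^+ n], which by [tail_prob0] is the total weight, turns the
    weights of the first step into the probabilities [qm], [q0], [qp]. *)
Definition tail_prob (n k : nat) (st : int * int) : R :=
  \sum_(w : motzkin_walk n)
    walk_weight pm1 p0 p1 w * (k <= changes st w)%N%:R / Z ^+ n.

Lemma tail_probS (n k : nat) (st : int * int) : tail_prob n.+1 k st =
  qm * tail_prob n (k - flips st down_step) (advance st down_step) +
  q0 * tail_prob n (k - flips st motzkin_step0) (advance st motzkin_step0) +
  qp * tail_prob n (k - flips st up_step) (advance st up_step).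
Proof.
rewrite /tail_prob /walk_weight (sum_tuple_cons _ _ _ (fun w : seq motzkin_step =>
  (\prod_(s <- w) step_weight pm1 p0 p1 s) * (k <= changes st w)%N%:R / Z ^+ n.+1)).
rewrite sum_motzkin_step !mulr_sumr.
by congr (_ + _ + _); apply: eq_bigr => w _; rewrite big_cons /= leq_subLR exprS;
  rewrite invfM /step_weight /=; ring.
Qed.

Lemma tail_prob0 (n : nat) (st : int * int) : tail_prob n 0 st = 1.
Proof.
elim: n st => [|n IH] st; last by rewrite tail_probS !IH !mulr1 sum_step_prob.
rewrite /tail_prob (bigD1 [tuple]) //= big1 => [|w]; last by move=> /eqP []; exact: tuple0.
by rewrite /walk_weight big_nil expr0 divr1 mulr1 addr0.
Qed.

Lemma tail_prob0S (k : nat) (st : int * int) : tail_prob 0 k.+1 st = 0.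
Proof. by rewrite /tail_prob big1 // => w _; rewrite tuple0 /= mulr0 mul0r. Qed.

(** The heart of the argument. Away from the axis, both sides obey the
    recursion of [hit], where for the lower half-plane the factor [rho ^+ m]
    exchanges [qm] and [qp]. On the axis, the step to the opposite side leaves
    [k] changes to be made from distance 1, so that the level to be visited
    gets closer by 1, from [2k + 1] to [2k], as in the recursion of [hit]. In the
    exponents, each sign change from below to above contributes 2, except that
    the first one contributes [m + 1] if the walk is at [- m] already. *)
Lemma tail_prob_signed (n k m : nat) :
  tail_prob n k.+1 (m%:Z, 1) =
    rho ^+ (k.+1)./2.*2 * hit qm q0 qp n (m + k.*2.+1) /\
  tail_prob n k.+1 (- m%:Z, -1) =
    rho ^+ (m + (k./2.*2).+1) * hit qm q0 qp n (m + k.*2.+1).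
Proof.
have qpE : qp = qm * rho.
  by field; rewrite !gt_eqF // total_weight_gt0.
elim: n k m => [|n IH] k m; first by rewrite !tail_prob0S addnS /= !mulr0.
rewrite !tail_probS /advance /flips /=.
case: m => [|m].
- rewrite oppr0 !add0r /= !add0n !subn0 subn1 /=.
  have [IHp0 IHm0] := IH k 0%N; rewrite oppr0 in IHm0.
  rewrite sgzN sgz1 IHp0 IHm0 (IH k 1%N).1 (IH k 1%N).2 !add0n !add1n.
  case: k {IHp0 IHm0} => [|k].
    by rewrite !tail_prob0 hit0 qpE /=; split; ring.
  rewrite (IH k 1%N).1 (IH k 1%N).2 !add1n qpE /= !uphalf_half.
  by case: (odd k) => /=; rewrite ?add0n ?add1n !doubleS !exprS; split; ring.
- rewrite !addr0 addSn.
  have -> : m.+1%:Z - 1 = m%:Z by lia.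
  have -> : m.+1%:Z + 1 = m.+2%:Z by lia.
  have -> : - m.+1%:Z - 1 = - m.+2%:Z by lia.
  have -> : - m.+1%:Z + 1 = - m%:Z by lia.
  have sgzm (l : nat) : sgz l.+1%:Z = 1 by [].
  have -> : (if m%:Z == 0 then 1 else sgz m%:Z) = 1 by case: (m).
  have -> : (if - m%:Z == 0 then -1 else sgz (- m%:Z)) = -1 by case: (m).
  have -> : (m%:Z != 0) && (1 == - sgz m%:Z) = false by case: (m).
  have -> : (- m%:Z != 0) && (-1 == - sgz (- m%:Z)) = false by case: (m).
  rewrite !sgzN !sgzm /= !subn0.
  rewrite (IH k m).1 (IH k m).2 (IH k m.+1).1 (IH k m.+1).2 (IH k m.+2).1 (IH k m.+2).2.
  by rewrite !addSn !exprS qpE; split; ring.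
Qed.

(** The first nonzero step is up or down, and the two exponents of [rho]
    given by [tail_prob_signed] are [k] and [k + 2], or both [k + 1],
    according to the parity of [k]. In both cases the sum is
    [(qm + qp) * rho ^+ k.+1]. *)
Lemma tail_prob_start (n k : nat) : tail_prob n.+1 k.+1 (0, 0) =
  q0 * tail_prob n k.+1 (0, 0) +
  (1 - q0) * (rho ^+ k.+1 * hit qm q0 qp n k.+1.*2).
Proof.
have qpE : qp = qm * rho by field; rewrite !gt_eqF // total_weight_gt0.
have -> : 1 - q0 = qm + qp by rewrite -sum_step_prob; ring.
rewrite tail_probS /advance /flips /= !add0r /= !sgzN !sgz1 /= !subn0.
rewrite (tail_prob_signed n k 1).1 (tail_prob_signed n k 1).2 !add1n !qpE /=.
rewrite doubleS; set h := hit _ _ _ _ _; have kE := odd_double_half k.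
rewrite uphalf_half -[in rho ^+ k.+1]kE.
by case: (odd k) => /=; rewrite ?add0n ?add1n ?doubleS !exprS; ring.
Qed.

End tail.

(** * First passage under drift *)

Section hit_theory.
Context {R : realType}.

(** Every path to the level [- y] has [y] more down steps than up steps, so
    exchanging the two probabilities multiplies its weight by [rho ^+ y]. *)
Lemma hit_swap (qm q0 qp rho : R) (n y : nat) : qp = qm * rho ->
  hit qp q0 qm n y = rho ^+ y * hit qm q0 qp n y.
Proof.
move=> qpE; elim: n y => [|n IH] [|y] /=; rewrite ?expr0 ?mul1r ?mulr0 //.
by rewrite !IH qpE !exprS; ring.
Qed.

Lemma hit_bounds (qm q0 qp : R) (n y : nat) :
  0 <= qm -> 0 <= q0 -> 0 <= qp -> qm + q0 + qp = 1 ->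
  0 <= hit qm q0 qp n y <= 1.
Proof.
move=> qm0 q00 qp0 qE; elim: n y => [|n IH] [|y] /=; rewrite ?ler01 ?lexx //.
have /andP[a0 a1] := IH y; have /andP[b0 b1] := IH y.+1; have /andP[c0 c1] := IH y.+2.
by apply/andP; split; nra.
Qed.

(** Markov's inequality: a walk that has not visited [- y] has an altitude
    above [- y], and [qm / t + q0 + qp * t] is the mean of [t] to the power of
    one step. *)
Lemma hit_geometric_lower (qm q0 qp t : R) (n y : nat) :
  0 <= qm -> 0 <= q0 -> 0 <= qp -> qm + q0 + qp = 1 -> 1 <= t ->
  1 - t ^+ y * (qm / t + q0 + qp * t) ^+ n <= hit qm q0 qp n y.
Proof.
move=> qm0 q00 qp0 qE t1; have t0 : 0 < t by apply: lt_le_trans t1.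
set m := (qm / t + q0 + qp * t).
have m0 : 0 <= m by rewrite /m !addr_ge0 ?mulr_ge0 ?invr_ge0 // ltW.
elim: n y => [|n IH] [|y]; rewrite ?hit0.
- by rewrite !expr0 mulr1 subrr.
- by rewrite expr0 mulr1 subr_le0 exprn_ege1.
- by rewrite expr0 mul1r gerBl exprn_ge0.
- have := IH y; have := IH y.+1; have := IH y.+2 => /= Ha Hb Hc.
  have -> : t ^+ y.+1 * m ^+ n.+1 = qm * (t ^+ y * m ^+ n) +
      q0 * (t ^+ y.+1 * m ^+ n) + qp * (t ^+ y.+2 * m ^+ n).
    by rewrite !exprS {1}/m; field; rewrite gt_eqF.
  by rewrite -[1 in leLHS]qE; nra.
Qed.

Lemma hit_cvg1 (qm q0 qp : R) (y : nat) : 0 <= q0 -> 0 < qp -> qp < qm ->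
  qm + q0 + qp = 1 -> hit qm q0 qp n y @[n --> \oo] --> (1 : R).
Proof.
move=> q00 qp0 qpm qE; have qm0 : 0 < qm by apply: lt_trans qpm.
(* The mean of [t] to the power of one step is a convex function of [t]
   with value 1 at [t = 1] and at [t = qm / qp]; the midpoint of these two
   makes it smaller than 1. *)
pose t := (qm + qp) / (2 * qp).
have t1 : 1 <= t by rewrite /t ler_pdivlMr ?mulr_gt0 //; lra.
have t0 : 0 < t by apply: lt_le_trans t1.
pose m := qm / t + q0 + qp * t.
have mE : m = 1 - (qm - qp) ^+ 2 / (2 * (qm + qp)).
  have q0E : q0 = 1 - qm - qp by rewrite -qE; ring.
  by rewrite /m /t q0E; field; rewrite !gt_eqF // addr_gt0.
have m0 : 0 < m.
  have h1 : 0 < qm / t by rewrite divr_gt0.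
  have h2 : 0 < qp * t by rewrite mulr_gt0.
  by rewrite /m; lra.
have m1 : m < 1.
  by rewrite mE gtrBl; apply: divr_gt0; [apply: exprn_gt0; lra|lra].
apply: (@squeeze_cvgr _ _ _ _ (fun n => 1 - t ^+ y * m ^+ n) (cst 1)).
- apply: nearW => n; rewrite (hit_geometric_lower _ _ _ _ n y (ltW qm0) q00 (ltW qp0)) //=.
  by have /andP[] := @hit_bounds qm q0 qp n y (ltW qm0) q00 (ltW qp0) qE.
- rewrite -[X in _ --> X]subr0; apply: cvgB; first exact: cvg_cst.
  rewrite -[X in _ --> X](mulr0 (t ^+ y)); apply: cvgM; first exact: cvg_cst.
  by apply: cvg_expr; rewrite ger0_norm // ltW.
- exact: cvg_cst.
Qed.

(** The sequence [u] forgets its past at the geometric rate [q]. *)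
Lemma cvg_weighted_average (q l : R) (h u : R^nat) : 0 <= q < 1 ->
  (forall n, u n.+1 = q * u n + (1 - q) * h n) ->
  h n @[n --> \oo] --> l -> u n @[n --> \oo] --> l.
Proof.
move=> /andP[q0 q1] uE hl; apply/cvgrPdist_le => e e0.
have e2 : 0 < e / 2 by rewrite divr_gt0.
have /cvgrPdist_le /(_ _ e2) [N _ HN] := hl.
have bound m : `|l - u (m + N)%N| <= q ^+ m * `|l - u N| + e / 2.
  elim: m => [|m IH]; first by rewrite expr0 mul1r lerDl ltW.
  rewrite addSn uE.
  have -> : l - (q * u (m + N)%N + (1 - q) * h (m + N)%N) =
      q * (l - u (m + N)%N) + (1 - q) * (l - h (m + N)%N) by ring.
  rewrite (le_trans (ler_normD _ _)) // !normrM (ger0_norm q0).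
  have q1' : 0 <= 1 - q by rewrite subr_ge0 ltW.
  rewrite (ger0_norm q1') exprS.
  have := ler_wpM2l q0 IH; have := ler_wpM2l q1' (HN (m + N)%N (leq_addl _ _)).
  by move=> /=; lra.
have : q ^+ m * `|l - u N| @[m --> \oo] --> (0 : R).
  rewrite -[X in _ --> X](mul0r `|l - u N|); apply: cvgM; last exact: cvg_cst.
  by apply: cvg_expr; rewrite ger0_norm.
move=> /cvgrPdist_le /(_ _ e2) [M _ HM].
exists (M + N)%N => // n /= Mn.
have /subnK <- : (N <= n)%N by apply: leq_trans Mn; rewrite leq_addl.
rewrite (le_trans (bound _)) // [leRHS]splitr lerD2r.
have : (M <= n - N)%N by rewrite leq_subRL ?(leq_trans _ Mn) ?leq_addl // addnC.
move=> /HM /=; rewrite sub0r normrN; apply: le_trans.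
exact: ler_norm.
Qed.

End hit_theory.

(** * The geometric limit *)

Section drift.
Context {R : realType}.
Variables (pm1 p0 p1 : {posnum R}).
Local Notation Z := (total_weight pm1 p0 p1).
Local Notation qm := (pm1%:num / Z).
Local Notation q0 := (p0%:num / Z).
Local Notation qp := (p1%:num / Z).

Let Z0 : 0 < Z := total_weight_gt0 pm1 p0 p1.
Let qm0 : 0 < qm. Proof. exact: divr_gt0. Qed.
Let q00 : 0 < q0. Proof. exact: divr_gt0. Qed.
Let qp0 : 0 < qp. Proof. exact: divr_gt0. Qed.
Let qE : qm + q0 + qp = 1 := sum_step_prob pm1 p0 p1.

Lemma cvg_tail_prob_of_hit (k : nat) (l : R) :
  (p1%:num / pm1%:num) ^+ k.+1 * hit qm q0 qp n k.+1.*2 @[n --> \oo] --> l ->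
  tail_prob pm1 p0 p1 n k.+1 (0, 0) @[n --> \oo] --> l.
Proof.
apply: (@cvg_weighted_average _ q0) => [|n]; last exact: tail_prob_start.
by rewrite ltW //=; have := qE; have := qm0; have := qp0; lra.
Qed.

Lemma cvg_tail_prob_down (k : nat) : p1%:num < pm1%:num ->
  tail_prob pm1 p0 p1 n k (0, 0) @[n --> \oo] --> (p1%:num / pm1%:num) ^+ k.
Proof.
move=> lt_p; case: k => [|k].
  by under eq_fun do rewrite tail_prob0; exact: cvg_cst.
apply: cvg_tail_prob_of_hit; rewrite -[X in _ --> X]mulr1.
apply: cvgM; first exact: cvg_cst.
by apply: hit_cvg1 => //; rewrite ?ltr_pM2r ?invr_gt0 // ltW.
Qed.

(** Here [hit qm q0 qp n y] tends to [rho ^- y] rather than 1; exchanging up and down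
    steps reduces the claim to the case of negative drift. *)
Lemma cvg_tail_prob_up (k : nat) : pm1%:num < p1%:num ->
  tail_prob pm1 p0 p1 n k (0, 0) @[n --> \oo] --> (pm1%:num / p1%:num) ^+ k.
Proof.
move=> lt_p; case: k => [|k].
  by under eq_fun do rewrite tail_prob0; exact: cvg_cst.
apply: cvg_tail_prob_of_hit.
have swapE n : (p1%:num / pm1%:num) ^+ k.+1 * hit qm q0 qp n k.+1.*2 =
    (pm1%:num / p1%:num) ^+ k.+1 * hit qp q0 qm n k.+1.*2.
  rewrite [in RHS](@hit_swap _ qm q0 qp (p1%:num / pm1%:num)); last first.
    by field; rewrite !gt_eqF.
  rewrite mulrA -muln2 mulnC exprM -exprMn; congr (_ ^+ _ * _).
  by field; rewrite !gt_eqF.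
rewrite (funext swapE) -[X in _ --> X]mulr1; apply: cvgM; first exact: cvg_cst.
by apply: hit_cvg1 => //; rewrite ?ltr_pM2r ?invr_gt0 // ?ltW // -qE; ring.
Qed.

Lemma motzkin_prob_tail (n k : nat) (A : set (motzkin_walk n)) :
  (forall w, A w <-> (nb_sign_changes w < k)%N) ->
  motzkin_prob pm1 p0 p1 n A = (1 - tail_prob pm1 p0 p1 n k (0, 0))%:E.
Proof.
move=> AE.
have totE : \sum_(w : motzkin_walk n) walk_weight pm1 p0 p1 w = Z ^+ n.
  have := tail_prob0 pm1 p0 p1 n (0, 0); rewrite /tail_prob -mulr_suml.
  move=> /(canRL (divfK (lt0r_neq0 (exprn_gt0 n Z0)))).
  by rewrite mul1r => <-; apply: eq_bigr => w _; rewrite mulr1.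
rewrite /motzkin_prob totE; congr (_%:E).
rewrite -(tail_prob0 pm1 p0 p1 n (0, 0)) /tail_prob -sumrB mulr_suml big_mkcond.
apply: eq_bigr => w _ /=; rewrite -nb_sign_changesE.
case: ifPn => [/set_mem/AE|/negP wA].
  by rewrite ltnNge => /negbTE ->; rewrite !mulr1 mulr0 mul0r subr0.
have -> : (k <= nb_sign_changes w)%N.
  by rewrite leqNgt; apply/negP => /AE /mem_set.
by rewrite subrr.
Qed.

End drift.

Section geometric.
Context {R : realType}.

Lemma Geom_le (l x : R) : 0 <= l < 1 -> 0 <= x ->
  Geom l `]-oo, x]%classic = (1 - l ^+ (Num.truncn x).+1)%:E.
Proof.
move=> l01 x0; have /andP[l0 l1] := l01.
rewrite /Geom /distribution /pushforward /= /geometric_prob l01.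
set A := (X in esum X).
have -> : A = `I_(Num.truncn x).+1.
  by apply/seteqP; split => k; rewrite /A /= in_itv /= /nat_to_real ltnS truncn_ge_nat.
rewrite esum_fset //; last first.
  by move=> k _; rewrite lee_fin mulr_ge0 ?exprn_ge0 ?subr_ge0 ?(ltW l1).
rewrite -fsbig_ord sumEFin -mulr_sumr; congr (_%:E).
by rewrite -{2}[1](expr1n _ (Num.truncn x).+1) subrXX; congr (_ * _);
  apply: eq_bigr => i _; rewrite expr1n mul1r.
Qed.

Lemma Geom_lt0 (l x : R) : x < 0 -> Geom l `]-oo, x]%classic = 0%E.
Proof.
move=> x0; rewrite /Geom /distribution /pushforward /=.
rewrite (_ : _ @^-1` _ = set0) ?measure0 // -subset0 => k /=.
by rewrite in_itv /= /nat_to_real leNgt (lt_le_trans x0).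
Qed.
End geometric.

(** * The normal distribution function over one time step *)

Section mean_value.
Context {R : realType}.

Lemma mean_value (f df : R -> R) (a b : R) : a <= b ->
  (forall x : R, is_derive x 1 f (df x)) ->
  exists2 c, a <= c <= b & f b - f a = df c * (b - a).
Proof.
move=> ab fdf.
have cf : continuous f.
  move=> x; apply/differentiable_continuous/derivable1_diffP.
  by have [] := fdf x.
have [c cab fE] := MVT_segment ab (fun x _ => fdf x) (continuous_subspaceT cf).
by exists c => //; rewrite in_itv /= in cab.
Qed.

Lemma is_derive_mean (f df : R -> R) (B : R) (x y : R) :
  (forall x : R, is_derive x 1 f (df x)) -> (forall x, `|df x| <= B) ->
  `|f x - f y| <= B * `|x - y|.
Proof.
move=> fdf dfB; wlog yx : x y / y <= x.
  move=> H; have [|/ltW xy] := leP y x; first exact: H.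
  by rewrite distrC [`|x - y|]distrC; exact: H.
have [c _ ->] := mean_value _ _ _ _ yx fdf.
by rewrite normrM ler_wpM2r.
Qed.

End mean_value.

Section heat.
Context {R : realType}.
Variables (Phi phi : R -> R) (C kappa : R).
Hypothesis C0 : 0 <= C.
Hypothesis kappa0 : 0 < kappa.
Hypothesis phiE : forall x, phi x = C * expR (- (kappa * x ^+ 2)).
Hypothesis dPhi : forall x : R, is_derive x 1 Phi (phi x).

(** Up to the factor [- 2 * kappa], [psi] is the second derivative of [Phi]. *)
Let psi (x : R) := x * phi x.
Let dpsi (x : R) := (1 - 2 * kappa * x ^+ 2) * phi x.

Let dphi (x : R) : is_derive x 1 phi (- (2 * kappa) * psi x).
Proof.
rewrite (funext phiE) /psi phiE.
apply: is_derive_eq.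
by rewrite /GRing.scale /=; ring.
Qed.

Let dpsiP (x : R) : is_derive x 1 psi (dpsi x).
Proof.
rewrite /psi; have := dphi x => ?.
apply: is_derive_eq.
by rewrite /GRing.scale /= /dpsi /psi; ring.
Qed.

(** A common bound for [psi], its derivative and [x * psi' x]. *)
Definition gauss_bound := C * (3 + 9 / kappa).

Let bounds (x : R) :
  [/\ `|psi x| <= gauss_bound, `|dpsi x| <= gauss_bound & `|x * dpsi x| <= gauss_bound].
Proof.
rewrite /dpsi /psi phiE /gauss_bound.
set u := kappa * x ^+ 2; set E := expR (- u).
have u0 : 0 <= u by rewrite mulr_ge0 ?sqr_ge0 // ltW.
have E0 : 0 <= E by exact: expR_ge0.
have k0 : 0 <= kappa^-1 by rewrite invr_ge0 ltW.
have Ek : kappa * kappa^-1 = 1 by rewrite divff // gt_eqF.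
have E1 : E <= 1 by rewrite -expR0 ler_expR oppr_le0.
have uE : u * E <= 1.
  have /(ler_wpM2r E0) := expR_ge1Dx u.
  by rewrite -expRD subrr expR0; lra.
have u2E : u ^+ 2 * E <= 4.
  have h := expR_ge1Dx (u / 2).
  have : (u / 2) ^+ 2 <= expR (u / 2) ^+ 2.
    by rewrite ler_pXn2r // ?nnegrE ?expR_ge0 ?divr_ge0 //; lra.
  rewrite expr2 [in leRHS]expr2 -expRD -splitr => /(ler_wpM2r E0).
  by rewrite -expRD subrr expR0; lra.
have x2E : x ^+ 2 * E <= kappa^-1.
  by move: (ler_wpM2l k0 uE); rewrite /u !mulrA [_^-1 * kappa]mulrC Ek; lra.
have xE : `|x| * E <= 1 + kappa^-1.
  have : `|x| <= 1 + x ^+ 2 by rewrite -real_normK ?num_real //; nra.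
  by move=> /(ler_wpM2r E0); lra.
have x3E : `|x| * u * E <= 1 + 4 / kappa.
  have : `|x| * u <= u + u * x ^+ 2.
    have : `|x| <= 1 + x ^+ 2 by rewrite -real_normK ?num_real //; nra.
    by move=> /(ler_wpM2r u0); lra.
  have x2E' : u * x ^+ 2 = u ^+ 2 / kappa.
    by rewrite /u; field; rewrite gt_eqF.
  move=> /(ler_wpM2r E0); rewrite x2E'.
  by have := ler_wpM2l k0 u2E; lra.
have cE : 1 + kappa^-1 + 2 * (1 + 4 / kappa) = 3 + 9 / kappa by ring.
have psiB : `|x * (C * E)| <= C * (1 + kappa^-1).
  by rewrite !normrM (ger0_norm C0) (ger0_norm E0) mulrCA ler_wpM2l.
have d1 : `|1 - 2 * u| <= 1 + 2 * u.
  by rewrite (le_trans (ler_normB _ _)) // normr1 ger0_norm // mulr_ge0.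
have two : 2 * kappa * x ^+ 2 = 2 * u by rewrite /u mulrA.
split.
- by rewrite (le_trans psiB) // ler_wpM2l //; lra.
- rewrite two !normrM (ger0_norm C0) (ger0_norm E0) [`|1 - 2 * u| * _]mulrCA ler_wpM2l //.
  by move: d1 => /(ler_wpM2r E0); lra.
- rewrite two !normrM (ger0_norm C0) (ger0_norm E0).
  rewrite [`|1 - 2 * u| * _]mulrCA [`|x| * _]mulrCA ler_wpM2l //.
  have /(ler_wpM2r E0) /(ler_wpM2l (normr_ge0 x)) := d1.
  by move: xE x3E; rewrite -cE; set ix := `|x|; lra.
Qed.

(** Taylor expansion to the second order, with a remainder of the third
    order because [psi] is Lipschitz. *)
Let second_difference (z a : R) : 0 <= a ->
  `|Phi (z + a) + Phi (z - a) - 2 * Phi z + 2 * kappa * psi z * a ^+ 2| <=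
  4 * kappa * gauss_bound * a ^+ 3.
Proof.
move=> a0.
pose h (t : R) := Phi (z + t) + Phi (z - t) - 2 * Phi z + 2 * kappa * psi z * t ^+ 2.
pose dh (t : R) := phi (z + t) - phi (z - t) + 4 * kappa * psi z * t.
have dh_h (t : R) : is_derive t 1 h (dh t).
  rewrite /h.
  have d1 : is_derive t 1 (fun u => Phi (z + u)) (phi (z + t)).
    by apply: is_derive_eq; rewrite /GRing.scale /=; ring.
  have d2 : is_derive t 1 (fun u => Phi (z - u)) (- phi (z - t)).
    by apply: is_derive_eq; rewrite /GRing.scale /=; ring.
  apply: is_derive_eq.
  by rewrite /GRing.scale /= /dh; ring.
have [c /andP[c0 ca] hE] := mean_value _ _ _ _ a0 dh_h.
have h0 : h 0 = 0 by rewrite /h addr0 subr0; ring.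
move: hE; rewrite h0 !subr0 => hE.
rewrite -[X in `|X|]/(h a) hE normrM (ger0_norm a0).
pose g (t : R) := phi (z + t) - phi (z - t).
have dg (t : R) : is_derive t 1 g (- (2 * kappa) * (psi (z + t) + psi (z - t))).
  rewrite /g.
  have d1 : is_derive t 1 (fun u => phi (z + u)) (- (2 * kappa) * psi (z + t)).
    have dphi_zt := dphi (z + t).
    by apply: is_derive_eq; rewrite /GRing.scale /=; ring.
  have d2 : is_derive t 1 (fun u => phi (z - u)) (2 * kappa * psi (z - t)).
    have dphi_zt := dphi (z - t).
    by apply: is_derive_eq; rewrite /GRing.scale /=; ring.
  by apply: is_derive_eq; ring.
have [e /andP[e0 ec] gE] := mean_value _ _ _ _ c0 dg.
have g0 : g 0 = 0 by rewrite /g addr0 subr0 subrr.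
move: gE; rewrite g0 !subr0 => gE.
have -> : dh c = 2 * kappa * c * ((psi z - psi (z + e)) + (psi z - psi (z - e))).
  by rewrite /dh -/(g c) gE; ring.
have lip (x y : R) := is_derive_mean psi dpsi gauss_bound x y dpsiP
  (fun x => let: And3 _ b _ := bounds x in b).
have B0 : 0 <= gauss_bound by have [+ _ _] := bounds 0; apply: le_trans.
have k2c : 0 <= 2 * kappa * c by rewrite !mulr_ge0 // ltW.
rewrite normrM (ger0_norm k2c).
have l1 := lip z (z + e); have l2 := lip z (z - e).
have e1 : z - (z + e) = - e by ring.
have e2 : z - (z - e) = e by ring.
rewrite e1 normrN (ger0_norm e0) in l1; rewrite e2 (ger0_norm e0) in l2.
have l3 : `|psi z - psi (z + e) + (psi z - psi (z - e))| <= 2 * gauss_bound * a.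
  rewrite (le_trans (ler_normD _ _)) // (le_trans (lerD l1 l2)) //.
  have := ler_wpM2l B0 (le_trans ec ca); lra.
apply: (le_trans (ler_wpM2r a0 (ler_wpM2l k2c l3))).
have k4 : 0 <= 4 * kappa * gauss_bound * a ^+ 2.
  apply: mulr_ge0; last exact: sqr_ge0.
  by apply: mulr_ge0 => //; apply: mulr_ge0 => //; exact: ltW.
by have := ler_wpM2l k4 ca; lra.
Qed.

(** With [a = t ^ (-1/2)], the relation between [a] and [a'] says that [t]
    grows by [4 * q * kappa]. The function [Phi (y / sqrt t)] solves the heat
    equation, in which a time derivative equals a multiple of a second space
    derivative. The second difference and the increment in time are both
    equal to [- 2 * kappa * q * a ^+ 2 * psi (a * y)] up to the third order,
    which leaves an error of order [a ^+ 3]. *)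
Lemma heat_step (q a a' y : R) : 0 <= q -> 0 < a' -> a' <= a -> a <= 1 ->
  a ^+ 2 - a' ^+ 2 = 4 * q * kappa * a ^+ 2 * a' ^+ 2 ->
  `|q * (Phi (a * (y + 1)) + Phi (a * (y - 1)) - 2 * Phi (a * y)) -
    (Phi (a' * y) - Phi (a * y))| <=
  4 * q * kappa * gauss_bound * (1 + 4 * q * kappa) * a ^+ 3.
Proof.
move=> q0 a'0 a'a a1 aE; have a0 : 0 < a by apply: lt_le_trans a'a.
set tau := 4 * q * kappa in aE *.
have tau0 : 0 <= tau by rewrite !mulr_ge0 // ltW.
have B0 : 0 <= gauss_bound by have [+ _ _] := bounds 0; apply: le_trans.
have S := second_difference (a * y) a (ltW a0).
have -> : a * (y + 1) = a * y + a by ring.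
have -> : a * (y - 1) = a * y - a by ring.
have dt (t : R) : is_derive t 1 (fun u => Phi (u * y)) (y * phi (t * y)).
  by apply: is_derive_eq; rewrite /GRing.scale /=; ring.
have [z /andP[a'z za] zE] := mean_value _ _ _ _ a'a dt.
have z0 : 0 < z by apply: lt_le_trans a'z.
have dpt (t : R) : is_derive t 1 (fun u => psi (u * y)) (y * dpsi (t * y)).
  have d := dpsiP (t * y).
  by apply: is_derive_eq; rewrite /GRing.scale /=; ring.
have [x /andP[zx xa] xE] := mean_value _ _ _ _ za dpt.
have x0 : 0 < x by apply: lt_le_trans zx.
(* The increment in time is [r] times a value of [psi]; the two bounds below
   compare [r] with [2 * kappa * q * a ^+ 2]. *)
pose r := (a - a') / z.
have zE' : Phi (a * y) - Phi (a' * y) = r * psi (z * y).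
  by rewrite zE /r /psi; field; rewrite gt_eqF.
have [psiz _ _] := bounds (z * y).
have [_ _ xdpsi] := bounds (x * y).
have ineq1 : (a - a') <= tau / 2 * a ^+ 2 * a'.
  have : (a - a') * (a + a') <= tau / 2 * a ^+ 2 * a' * (a + a').
    have -> : (a - a') * (a + a') = tau * a ^+ 2 * a' ^+ 2 by rewrite -aE; ring.
    have p0 : 0 <= tau / 2 * a ^+ 2 * a' by rewrite !mulr_ge0 ?sqr_ge0 // ltW.
    by have := ler_wpM2l p0 a'a; lra.
  by rewrite ler_pM2r // addr_gt0.
have ineq2 : tau / 2 * a' ^+ 2 * a <= a - a'.
  have : tau / 2 * a' ^+ 2 * a * (a + a') <= (a - a') * (a + a').
    have -> : (a - a') * (a + a') = tau * a ^+ 2 * a' ^+ 2 by rewrite -aE; ring.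
    have p0 : 0 <= tau / 2 * a * a' ^+ 2 by rewrite !mulr_ge0 ?sqr_ge0 // ltW.
    by have := ler_wpM2l p0 a'a; lra.
  by rewrite ler_pM2r // addr_gt0.
have r_le : r <= tau / 2 * a ^+ 2.
  rewrite /r ler_pdivrMr // (le_trans ineq1) // ler_wpM2l //.
  by apply: mulr_ge0; [exact: divr_ge0|exact: sqr_ge0].
have r_ge : tau / 2 * a' ^+ 2 <= r.
  rewrite /r ler_pdivlMr // (le_trans _ ineq2) // ler_wpM2l //.
  by apply: mulr_ge0; [exact: divr_ge0|exact: sqr_ge0].
have a4 : tau / 2 * (tau * a ^+ 2 * a' ^+ 2) <= tau / 2 * (tau * a ^+ 3).
  have aa3 : a ^+ 2 * a' ^+ 2 <= a ^+ 3.
    rewrite [a ^+ 3]exprSr; apply: ler_wpM2l; first exact: sqr_ge0.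
    rewrite expr2 -[leRHS]mulr1; apply: ler_pM; rewrite ?(ltW a'0) //.
    exact: le_trans a'a a1.
  have tau2 : 0 <= tau / 2 * tau by apply: mulr_ge0 => //; exact: divr_ge0.
  by have := ler_wpM2l tau2 aa3; lra.
have a43 : a ^+ 4 <= a ^+ 3.
  by rewrite exprSr -[leRHS]mulr1 ler_wpM2l // exprn_ge0 // ltW.
have coef : `|tau / 2 * a ^+ 2 - r| <= tau / 2 * (tau * a ^+ 3).
  rewrite ger0_norm ?subr_ge0 //; apply: le_trans a4; rewrite -aE; lra.
have psid : `|psi (z * y) - psi (a * y)| <= gauss_bound * (tau / 2 * a ^+ 2).
  rewrite distrC xE normrM (ger0_norm (_ : 0 <= a - z)) ?subr_ge0 //.
  have -> : y * dpsi (x * y) = (x * y * dpsi (x * y)) / x.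
    by field; rewrite gt_eqF.
  rewrite normrM normfV (gtr0_norm x0) -mulrA; apply: ler_pM => //.
    by rewrite mulr_ge0 // ?invr_ge0 ?subr_ge0 // ltW.
  rewrite mulrC ler_pdivrMr //.
  rewrite (le_trans (_ : _ <= a - a')) ?lerB // (le_trans ineq1) // ler_wpM2l //.
    by apply: mulr_ge0; [exact: divr_ge0|exact: sqr_ge0].
  exact: le_trans a'z zx.
have -> : q * (Phi (a * y + a) + Phi (a * y - a) - 2 * Phi (a * y)) -
    (Phi (a' * y) - Phi (a * y)) =
  q * (Phi (a * y + a) + Phi (a * y - a) - 2 * Phi (a * y) +
    2 * kappa * psi (a * y) * a ^+ 2) +
  (tau / 2 * a ^+ 2 * (psi (z * y) - psi (a * y)) -
   (tau / 2 * a ^+ 2 - r) * psi (z * y)).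
  have -> : Phi (a' * y) = Phi (a * y) - r * psi (z * y) by rewrite -zE'; ring.
  by rewrite /tau; field.
have n1 := ler_wpM2l q0 S.
have p0 : 0 <= tau / 2 * a ^+ 2.
  by apply: mulr_ge0; [exact: divr_ge0|exact: sqr_ge0].
have n2 := ler_wpM2l p0 psid.
have n3 := ler_pM (normr_ge0 _) (normr_ge0 _) coef psiz.
have n4 : tau / 2 * a ^+ 2 * (gauss_bound * (tau / 2 * a ^+ 2)) <=
    gauss_bound * (tau / 2) ^+ 2 * a ^+ 3.
  have p1 : 0 <= gauss_bound * (tau / 2) ^+ 2 by apply: mulr_ge0 => //; exact: sqr_ge0.
  by have := ler_wpM2l p1 a43; lra.
rewrite (le_trans (ler_normD _ _)) // normrM (ger0_norm q0).
have n5 := ler_normB (tau / 2 * a ^+ 2 * (psi (z * y) - psi (a * y)))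
   ((tau / 2 * a ^+ 2 - r) * psi (z * y)).
rewrite [`|_ * (psi _ - psi _)|]normrM [`|_ * psi (z * y)|]normrM (ger0_norm p0) in n5.
have n6 : q * (4 * kappa * gauss_bound * a ^+ 3) = tau * gauss_bound * a ^+ 3.
  by rewrite /tau; ring.
rewrite n6 in n1.
have n7 : 0 <= gauss_bound * tau ^+ 2 * a ^+ 3.
  apply: mulr_ge0; last by rewrite exprn_ge0 // ltW.
  by apply: mulr_ge0 => //; exact: sqr_ge0.
by lra.
Qed.

End heat.

(** * Barriers for first passage without drift *)

Section barrier.
Context {R : realType}.
Variables (Phi : R -> R) (q D M : R) (a : R^nat).
Hypothesis Phi_ndecr : {homo Phi : x y / x <= y}.
Hypothesis Phi_sym : forall x, Phi x + Phi (- x) = 1.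
Hypothesis Phi01 : forall x, 0 <= Phi x <= 1.
Hypothesis q0 : 0 <= q.
Hypothesis q_half : 2 * q <= 1.
Hypothesis D0 : 0 <= D.
Hypothesis M0 : 0 <= M.
Hypothesis a_gt0 : forall n, 0 < a n.
Hypothesis a0_le1 : a 0%N <= 1.
(* That is, [a n ^- 2] grows by 4 at each step. *)
Hypothesis aS : forall n, a n ^+ 2 - a n.+1 ^+ 2 = 4 * a n ^+ 2 * a n.+1 ^+ 2.
Hypothesis heat : forall b b' y : R, 0 < b' -> b' <= b -> b <= 1 ->
  b ^+ 2 - b' ^+ 2 = 4 * b ^+ 2 * b' ^+ 2 ->
  `|q * (Phi (b * (y + 1)) + Phi (b * (y - 1)) - 2 * Phi (b * y)) -
    (Phi (b' * y) - Phi (b * y))| <= D * b ^+ 3.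

Let a_decr (n : nat) : a n.+1 <= a n.
Proof.
rewrite -(@ler_pXn2r _ 2) ?nnegrE //; [|exact: ltW|exact: ltW].
rewrite -subr_ge0 aS.
by apply: mulr_ge0; [apply: mulr_ge0 => //|]; exact: sqr_ge0.
Qed.

Let a_le (n : nat) : a n <= a 0%N.
Proof. by elim: n => // n IH; exact: le_trans (a_decr n) IH. Qed.

Let e := D * a 0%N ^+ 3.

Let e0 : 0 <= e.
Proof. by rewrite mulr_ge0 // exprn_ge0 // ltW. Qed.

Let step (n : nat) (y : R) :
  `|q * Phi (a n * (y - 1)) + (1 - 2 * q) * Phi (a n * y) +
    q * Phi (a n * (y + 1)) - Phi (a n.+1 * y)| <= e.
Proof.
have := heat _ _ y (a_gt0 n.+1) (a_decr n) (le_trans (a_le n) a0_le1) (aS n).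
set X := q * (_ - _) - _ => H.
have -> : q * Phi (a n * (y - 1)) + (1 - 2 * q) * Phi (a n * y) +
    q * Phi (a n * (y + 1)) - Phi (a n.+1 * y) = X by rewrite /X; ring.
apply: le_trans H _; apply: ler_wpM2l => //.
by apply: lerXn2r; rewrite ?nnegrE ?a_le // ltW.
Qed.

(** The shift by [M] and the term with [a 0 * M] make the barriers correct at
    time 0, where [hit] is a step function and [Phi] is smooth. The last term
    absorbs the errors of [heat_step] at the [n] steps made so far. *)
Definition upper_barrier (n : nat) (y : R) : R :=
  2 * (1 - Phi (a n * (y - M))) + 2 * (1 - Phi (a 0%N * M)) + 2 * (n%:R * e).

Definition lower_barrier (n : nat) (y : R) : R :=
  2 * (1 - Phi (a n * (y + M))) - 2 * (1 - Phi (a 0%N * M)) - 2 * (n%:R * e).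

Let upper_step (n : nat) (y : R) :
  q * upper_barrier n (y - 1) + (1 - 2 * q) * upper_barrier n y +
  q * upper_barrier n (y + 1) <= upper_barrier n.+1 y.
Proof.
have := step n (y - M); rewrite ler_norml => /andP[+ _]; rewrite /upper_barrier.
have -> : y - M - 1 = y - 1 - M by ring.
have -> : y - M + 1 = y + 1 - M by ring.
by rewrite -[n.+1%:R]natr1; lra.
Qed.

Let lower_step (n : nat) (y : R) : lower_barrier n.+1 y <=
  q * lower_barrier n (y - 1) + (1 - 2 * q) * lower_barrier n y +
  q * lower_barrier n (y + 1).
Proof.
have := step n (y + M); rewrite ler_norml => /andP[_]; rewrite /lower_barrier.
have -> : y + M - 1 = y - 1 + M by ring.
have -> : y + M + 1 = y + 1 + M by ring.
by rewrite -[n.+1%:R]natr1; lra.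
Qed.

Let Phi_le_half (x : R) : x <= 0 -> 2 * Phi x <= 1.
Proof.
move=> x0; have := Phi_sym x.
have : Phi x <= Phi (- x) by apply: Phi_ndecr; lra.
by lra.
Qed.

Let upper_ge0 (n : nat) (y : R) : 0 <= upper_barrier n y.
Proof.
have /andP[_ h1] := Phi01 (a n * (y - M)); have /andP[_ h2] := Phi01 (a 0%N * M).
have : 0 <= n%:R * e by rewrite mulr_ge0.
by rewrite /upper_barrier; lra.
Qed.

Let upper_ge1 (n : nat) (y : R) : y <= 0 -> 1 <= upper_barrier n y.
Proof.
move=> y0.
have h1 : 2 * Phi (a n * (y - M)) <= 1.
  by apply: Phi_le_half; rewrite pmulr_rle0 //; move: M0 y0; lra.
have /andP[_ h2] := Phi01 (a 0%N * M).
have : 0 <= n%:R * e by rewrite mulr_ge0.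
by rewrite /upper_barrier; lra.
Qed.

Let lower_le1 (n : nat) (y : R) : 0 <= y -> lower_barrier n y <= 1.
Proof.
move=> y0.
have h1 : 2 * Phi (- (a n * (y + M))) <= 1.
  by apply: Phi_le_half; rewrite oppr_le0 mulr_ge0 ?addr_ge0 // ltW.
have h3 := Phi_sym (a n * (y + M)).
have /andP[_ h2] := Phi01 (a 0%N * M).
have : 0 <= n%:R * e by rewrite mulr_ge0.
by rewrite /lower_barrier; lra.
Qed.

Let lower0_le0 (y : R) : 0 <= y -> lower_barrier 0 y <= 0.
Proof.
move=> y0; rewrite /lower_barrier mul0r mulr0 subr0 subr_le0 ler_pM2l // lerB //.
by apply: Phi_ndecr; rewrite ler_pM2l // lerDr.
Qed.

Let upper_decr (n : nat) (x y : R) : x <= y -> upper_barrier n y <= upper_barrier n x.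
Proof.
move=> xy; have : Phi (a n * (x - M)) <= Phi (a n * (y - M)).
  by apply: Phi_ndecr; rewrite ler_pM2l // lerB.
by rewrite /upper_barrier; lra.
Qed.

Let lower_decr (n : nat) (x y : R) : x <= y -> lower_barrier n y <= lower_barrier n x.
Proof.
move=> xy; have : Phi (a n * (x + M)) <= Phi (a n * (y + M)).
  by apply: Phi_ndecr; rewrite ler_pM2l // lerD.
by rewrite /lower_barrier; lra.
Qed.

Let average_le (x1 x2 x3 y1 y2 y3 : R) : x1 <= y1 -> x2 <= y2 -> x3 <= y3 ->
  q * x1 + (1 - 2 * q) * x2 + q * x3 <= q * y1 + (1 - 2 * q) * y2 + q * y3.
Proof.
move=> h1 h2 h3.
by rewrite !lerD // ler_wpM2l // subr_ge0.
Qed.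

(** A discrete maximum principle. At [y = 0], where [hit] is 1, the barriers
    are on the right side because [Phi] is 1/2 at 0 and is monotone. *)
Lemma hit_barriers (n y : nat) :
  lower_barrier n y%:R <= hit q (1 - 2 * q) q n y <= upper_barrier n y%:R.
Proof.
elim: n y => [|n IH] [|y]; rewrite ?hit0.
- by rewrite lower_le1 ?upper_ge1.
- by rewrite lower0_le0 ?upper_ge0.
- by rewrite lower_le1 ?upper_ge1.
- have := lower_step n y.+1%:R; have := upper_step n y.+1%:R => /=.
  have -> : y.+1%:R - 1 = y%:R :> R by rewrite -natr1 addrK.
  rewrite natr1 => U L.
  have /andP[l0 u0] := IH y; have /andP[l1 u1] := IH y.+1; have /andP[l2 u2] := IH y.+2.
  by rewrite (le_trans L) ?(le_trans _ U) ?average_le.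
Qed.

(** The recursion of [u] differs from that of [hit] in that both neighbours
    of the point are replaced by [hit] at [y]. Since the barriers decrease in
    space, moving them by 1 makes up for this. *)
Lemma average_barriers (u : R^nat) (y : nat) : (0 < y)%N -> u 0%N = 0 ->
  (forall n, u n.+1 = (1 - 2 * q) * u n + 2 * q * hit q (1 - 2 * q) q n y) ->
  forall n, lower_barrier n (y%:R + 1) <= u n <= upper_barrier n (y%:R - 1).
Proof.
move=> y0 u0 uE; elim => [|n IH]; first by rewrite u0 lower0_le0 ?upper_ge0.
have /andP[l1 u1] := IH; have /andP[l2 u2] := hit_barriers n y.
have := lower_step n (y%:R + 1); have := upper_step n (y%:R - 1).
rewrite subrK addrK => U L.
have -> : u n.+1 = q * hit q (1 - 2 * q) q n y + (1 - 2 * q) * u n +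
    q * hit q (1 - 2 * q) q n y by rewrite uE; ring.
rewrite (le_trans L) ?(le_trans _ U) ?average_le //.
  by apply: le_trans u2 _; apply: upper_decr; lra.
by apply: le_trans l2; apply: lower_decr; lra.
Qed.

End barrier.

(** * The normal and half-normal distribution functions *)

Section gaussian_cdf.
Context {R : realType}.
Local Notation mu := lebesgue_measure.

Definition gauss_cdf (s x : R) : R :=
  (\int[mu]_(t in `]-oo, x]) normal_pdf 0 s t)%R.

Lemma normal_prob_le (s x : R) : normal_prob 0 s `]-oo, x]%classic = (gauss_cdf s x)%:E.
Proof.
rewrite /gauss_cdf /Rintegral fineK //.
exact: (fin_num_measure (normal_prob 0 s : probability _ R)).
Qed.

Lemma is_derive_gauss_cdf (s x : R) : s != 0 ->
  is_derive x 1 (gauss_cdf s) (normal_pdf 0 s x).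
Proof.
move=> s0; have x1 : x < x + 1 by rewrite ltrDl.
have int : mu.-integrable `]-oo, x + 1] (EFin \o normal_pdf 0 s).
  by apply: (integrableS _ _ (subsetT _)) => //; exact: integrable_normal_pdf.
have [d dE] : derivable (gauss_cdf s) x 1 /\ (gauss_cdf s)^`()%classic x = normal_pdf 0 s x.
  exact: continuous_FTC1 x1 int (ltNyr _) (@continuous_normal_pdf _ 0 s s0 x).
by apply: (DeriveDef d); rewrite -derive1E.
Qed.

Lemma gauss_cdf_ndecr (s : R) : {homo gauss_cdf s : x y / x <= y}.
Proof.
move=> x y xy; rewrite -lee_fin -!normal_prob_le le_measure ?inE //.
exact: subitvPr.
Qed.

Lemma gauss_cdf01 (s x : R) : 0 <= gauss_cdf s x <= 1.
Proof. by rewrite -!lee_fin -normal_prob_le measure_ge0 probability_le1. Qed.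

Let idTR : measurableTypeR R -> R := idfun.

#[local] HB.instance Definition _ :=
  @isMeasurableFun.Build _ _ _ _ idTR (@measurable_id _ _ setT).

Lemma cvg_gauss_cdfy (s : R) : gauss_cdf s x @[x --> +oo] --> (1 : R).
Proof.
have := @cvg_cdfy1 _ _ _ (normal_prob 0 s) idTR.
by move/fine_cvg.
Qed.

Lemma cvg_gauss_cdfNy (s : R) : gauss_cdf s x @[x --> -oo] --> (0 : R).
Proof.
have := @cvg_cdfNy0 _ _ _ (normal_prob 0 s) idTR.
by move/fine_cvg.
Qed.

(** The left-hand side has derivative 0, as the density is even, and tends to
    1 at infinity. *)
Lemma gauss_cdf_sym (s x : R) : s != 0 -> gauss_cdf s x + gauss_cdf s (- x) = 1.
Proof.
move=> s0; pose f y := gauss_cdf s y + gauss_cdf s (- y).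
have df (y : R) : is_derive y 1 f 0.
  rewrite /f; have d1 := is_derive_gauss_cdf s y s0.
  have d2 := is_derive_gauss_cdf s (- y) s0.
  apply: is_derive_eq.
  by rewrite /GRing.scale /= !normal_pdfE // /normal_fun !subr0 sqrrN; ring.
have fx y : f y = f x by exact: is_derive_0_is_cst.
have f1 : f y @[y --> +oo] --> (1 : R).
  rewrite -[X in _ --> X]addr0; apply: cvgD; first exact: cvg_gauss_cdfy.
  by apply/(cvgNy_compNP (gauss_cdf s)); exact: cvg_gauss_cdfNy.
have f2 : f y @[y --> +oo] --> f x.
  by rewrite (funext fx); exact: cvg_cst.
exact: (cvg_unique _ f2 f1).
Qed.

Lemma half_normal_le (s x : R) : 0 < s -> 0 <= x ->
  HalfNormal s `]-oo, x]%classic = (2 * gauss_cdf s x - 1)%:E.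
Proof.
move=> s0 x0; have s_neq0 : s != 0 by rewrite gt_eqF.
have -> : HalfNormal s `]-oo, x]%classic =
    (\int[mu]_(t in `]-oo, x]) (half_normal_pdf s t)%:E)%E.
  by rewrite /HalfNormal /= /half_normal_prob s0.
have pdfE : (fun t => (half_normal_pdf s t)%:E) =
    ((fun t => (2 * normal_pdf 0 s t)%:E) \_ `[0, +oo[).
  apply/funext => t; rewrite patchE /half_normal_pdf mem_setE in_itv /= andbT.
  case: ifP => // t0.
  rewrite normal_pdfE // /normal_peak /normal_fun subr0; congr (_%:E).
  rewrite [RHS]mulrA; congr (_ * _); last by rewrite mulNr mulr_natl.
  have p0 : 0 < s ^+ 2 * pi *+ 2 by rewrite pmulrn_lgt0 // mulr_gt0 ?pi_gt0 ?exprn_gt0.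
  apply/eqP; rewrite -(@eqrXn2 _ 2) ?mulr_ge0 ?invr_ge0 ?sqrtr_ge0 //.
  rewrite exprMn exprVn !sqr_sqrtr ?(ltW p0) //; last first.
    by rewrite divr_ge0 // mulr_ge0 ?pi_ge0 ?sqr_ge0.
  apply/eqP; move: (pi : R) (lt0r_neq0 (pi_gt0 R)) => P P0.
  by field; rewrite P0.
rewrite pdfE -integral_mkcondr.
have -> : `]-oo, x]%classic `&` `[0, +oo[%classic = `[0, x]%classic.
  by apply/seteqP; split => t /=; rewrite !in_itv /= ?andbT; [move=> [-> ->]|move=> /andP[]].
rewrite -integral_itv_obnd_cbnd; last first.
  apply/measurable_EFinP; apply: measurable_funTS; apply: measurable_funM => //.
  exact: measurable_normal_pdf.
under eq_integral do rewrite EFinM.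
rewrite ge0_integralZl //; last 2 first.
- by apply: measurable_funTS; apply/measurable_EFinP; exact: measurable_normal_pdf.
- by move=> t _; rewrite lee_fin normal_pdf_ge0.
have split_x : normal_prob 0 s `]-oo, x]%classic =
    (normal_prob 0 s `]-oo, 0%R]%classic + normal_prob 0 s `]0%R, x]%classic)%E.
  rewrite -measureU //; last first.
    by apply/seteqP; split => t //=; rewrite !in_itv /= => -[t0 /andP[]]; rewrite ltNge t0.
  by rewrite -itv_bndbnd_setU.
have half : gauss_cdf s 0 = 1 / 2.
  by have := gauss_cdf_sym s 0 s_neq0; rewrite oppr0; lra.
have -> : (\int[mu]_(t in `]0%R, x]) (normal_pdf 0 s t)%:E)%E = (gauss_cdf s x - 1 / 2)%:E.
  rewrite -[LHS]/(normal_prob 0 s `]0%R, x]%classic) -half EFinB -!normal_prob_le split_x.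
  by rewrite addeAC subee ?add0e // fin_num_measure.
by rewrite -EFinM; congr (_%:E); field.
Qed.

Lemma half_normal_lt0 (s x : R) : 0 < s -> x < 0 -> HalfNormal s `]-oo, x]%classic = 0%E.
Proof.
move=> s0 x0; rewrite /HalfNormal /= /half_normal_prob s0.
apply: integral0_eq => t /=; rewrite in_itv /= => tx.
by rewrite /half_normal_pdf leNgt (le_lt_trans tx x0).
Qed.
End gaussian_cdf.

(** * The limit of the first passage probability without drift *)

Section critical.
Context {R : realType}.

(** All scales are powers of [w = n ^ (-1/16)], which tends to 0: the square
    root of [n] is [w ^- 8], the barriers start at time [w ^- 12], that is
    [w ^+ 4 * n], and are shifted by [w ^- 7], that is [w * sqrt n]. This shift
    is [w^-1] times the length scale [w ^- 6] at the starting time, so that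
    the correction at time 0 vanishes, and the accumulated error
    [n * (w ^+ 6) ^+ 3 = w ^+ 2] vanishes as well. *)
Definition root16 (n : nat) : R :=
  Num.sqrt (Num.sqrt (Num.sqrt (Num.sqrt n%:R^-1))).

Lemma root16_gt0 (n : nat) : (0 < n)%N -> 0 < root16 n.
Proof. by move=> n0; rewrite !sqrtr_gt0 invr_gt0 ltr0n. Qed.

Lemma root16X8 (n : nat) : root16 n ^+ 8 = Num.sqrt n%:R^-1.
Proof.
by rewrite (exprM _ 2 4) (exprM _ 2 2) /root16 !sqr_sqrtr ?sqrtr_ge0.
Qed.

Lemma root16X16 (n : nat) : root16 n ^+ 16 = n%:R^-1.
Proof. by rewrite (exprM _ 8 2) root16X8 sqr_sqrtr // invr_ge0. Qed.

Lemma root16_le1 (n : nat) : root16 n <= 1.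
Proof.
rewrite -(@expr_le1 _ 16) ?sqrtr_ge0 // root16X16.
case: n => [|n]; first by rewrite invr0.
by rewrite invf_le1 ?ltr0n // ler1n.
Qed.

Lemma cvg_root16 : root16 n @[n --> \oo] --> (0 : R).
Proof.
have h : (n%:R^-1 : R) @[n --> \oo] --> (0 : R).
  apply/gtr0_cvgV0; last exact: cvgr_idn.
  by exists 1%N => // n /= n0; rewrite ltr0n.
have csqrt (f : R^nat) : f n @[n --> \oo] --> (0 : R) ->
    Num.sqrt (f n) @[n --> \oo] --> (0 : R).
  move=> f0; rewrite -[X in _ --> X]sqrtr0.
  exact: (continuous_cvg _ (@sqrt_continuous R 0) f0).
by do 4 apply: (csqrt).
Qed.

Variables (q s : R).
Hypothesis q0 : 0 < q.
Hypothesis q_half : 2 * q <= 1.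
Hypothesis s0 : 0 < s.
(* With this variance, [heat_step] has a time step of 4. *)
Hypothesis sE : s ^+ 2 = q / 2.

Let s_neq0 : s != 0. Proof. by rewrite gt_eqF. Qed.

Let D := 4 * q * q^-1 * gauss_bound (normal_peak s) q^-1 * (1 + 4 * q * q^-1).

Let D0 : 0 <= D.
Proof.
by rewrite /D /gauss_bound !mulr_ge0 ?addr_ge0 ?normal_peak_ge0 ?invr_ge0 //
  ?mulr_ge0 ?invr_ge0 ?invrK // ltW.
Qed.

Let heat (b b' y : R) : 0 < b' -> b' <= b -> b <= 1 ->
  b ^+ 2 - b' ^+ 2 = 4 * b ^+ 2 * b' ^+ 2 ->
  `|q * (gauss_cdf s (b * (y + 1)) + gauss_cdf s (b * (y - 1)) -
      2 * gauss_cdf s (b * y)) -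
    (gauss_cdf s (b' * y) - gauss_cdf s (b * y))| <= D * b ^+ 3.
Proof.
move=> b'0 b'b b1 bE.
apply: (heat_step (gauss_cdf s) (normal_pdf 0 s)) => //.
- exact: normal_peak_ge0.
- by rewrite invr_gt0.
- move=> x; rewrite normal_pdfE // /normal_fun subr0 sE; congr (_ * expR _).
  by field; rewrite gt_eqF.
- by move=> x; exact: is_derive_gauss_cdf.
- exact: ltW.
- by rewrite mulfK ?gt_eqF.
Qed.

Variable x : R.
Hypothesis x0 : 0 <= x.

Let den (w : R) := Num.sqrt (w ^+ 4 + 4).
Let remainder (w : R) := 2 * (1 - gauss_cdf s w^-1) + 2 * D * w ^+ 2.
Let low (w : R) :=
  2 * (1 - gauss_cdf s ((2 * x + 3 * w ^+ 8 + w) / den w)) - remainder w.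
Let up (w : R) :=
  2 * (1 - gauss_cdf s ((2 * x - w ^+ 8 - w) / den w)) + remainder w.

Let sandwich (n : nat) (u : R^nat) : (0 < n)%N ->
  u 0%N = 0 ->
  (forall m, u m.+1 = (1 - 2 * q) * u m +
    2 * q * hit q (1 - 2 * q) q m (Num.truncn (x * Num.sqrt n%:R)).+1.*2) ->
  low (root16 n) <= u n <= up (root16 n).
Proof.
move=> n0 u0 uS; set w := root16 n; set k := (Num.truncn _).+1 in uS.
have w0 : 0 < w by exact: root16_gt0.
have wn0 : w != 0 by rewrite gt_eqF.
have nE : n%:R = w ^- 16 by rewrite root16X16 invrK.
have rE : Num.sqrt n%:R = w ^- 8.
  by rewrite root16X8 sqrtrV ?invrK.
have wi0 m : 0 < w ^- m by rewrite invr_gt0 exprn_gt0.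
pose a (m : nat) := (Num.sqrt (w ^- 12 + 4 * m%:R))^-1.
have pos m : 0 < w ^- 12 + 4 * m%:R by rewrite ltr_pwDl // mulr_ge0.
have a2 m : a m ^+ 2 = (w ^- 12 + 4 * m%:R)^-1.
  by rewrite exprVn sqr_sqrtr // ltW.
have a0E : a 0%N = w ^+ 6.
  apply/eqP; rewrite -(@eqrXn2 _ 2) ?invr_ge0 ?sqrtr_ge0 ?exprn_ge0 ?(ltW w0) //.
  by rewrite a2 mulr0 addr0 invrK -exprM.
have den0 : 0 < w ^+ 4 + 4 by rewrite ltr_pwDl ?exprn_gt0.
have denw0 : 0 < den w by rewrite sqrtr_gt0.
have anE : a n = w ^+ 8 / den w.
  apply/eqP; rewrite -(@eqrXn2 _ 2) ?invr_ge0 ?sqrtr_ge0 ?divr_ge0 ?exprn_ge0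
    ?(ltW w0) ?(ltW denw0) //.
  rewrite a2 nE exprMn exprVn sqr_sqrtr ?(ltW den0) //; apply/eqP.
  by field; rewrite wn0 gt_eqF //= gt_eqF.
have /andP[lo hi] : lower_barrier (gauss_cdf s) D (w ^- 7) a n ((k.*2)%:R + 1) <= u n
    <= upper_barrier (gauss_cdf s) D (w ^- 7) a n ((k.*2)%:R - 1).
  apply: (average_barriers (gauss_cdf s) q) => //.
  - exact: gauss_cdf_ndecr.
  - by move=> z; exact: gauss_cdf_sym.
  - exact: gauss_cdf01.
  - exact: ltW.
  - exact: ltW.
  - by move=> m; rewrite invr_gt0 sqrtr_gt0.
  - by rewrite a0E exprn_ile1 ?root16_le1 // ltW.
  - move=> m; rewrite !a2 -[m.+1%:R]natr1 mulrDr mulr1 addrA.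
    have A0 := pos m; set A := w ^- 12 + _ in A0 *.
    by field; rewrite !gt_eqF // addr_gt0.
have xk : x * w ^- 8 <= k%:R.
  by rewrite -rE ltW // truncnS_gt.
have kx : k%:R <= x * w ^- 8 + 1.
  rewrite -natr1 lerD2r -rE truncn_le mulr_ge0 ?sqrtr_ge0 //.
have k2 : (k.*2)%:R = 2 * k%:R :> R by rewrite -mul2n natrM.
have e1 : a 0%N * w ^- 7 = w^-1 by rewrite a0E; field.
have e2 : n%:R * (D * a 0%N ^+ 3) = D * w ^+ 2.
  by rewrite a0E nE; field.
have remE : 2 * (1 - gauss_cdf s (a 0%N * w ^- 7)) + 2 * (n%:R * (D * a 0%N ^+ 3)) =
    remainder w by rewrite e1 e2 /remainder mulrA.
have an0 : 0 < a n by rewrite invr_gt0 sqrtr_gt0.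
move: lo hi; rewrite /lower_barrier /upper_barrier k2 => lo hi.
apply/andP; split.
- apply: le_trans lo; rewrite /low -remE.
  suff : gauss_cdf s (a n * (2 * k%:R + 1 + w ^- 7)) <=
      gauss_cdf s ((2 * x + 3 * w ^+ 8 + w) / den w) by lra.
  apply: gauss_cdf_ndecr.
  have -> : (2 * x + 3 * w ^+ 8 + w) / den w = a n * (2 * (x * w ^- 8 + 1) + 1 + w ^- 7).
    by rewrite anE; field; rewrite wn0 gt_eqF.
  by rewrite ler_pM2l // !lerD2r ler_pM2l.
- apply: (le_trans hi); rewrite /up -remE.
  suff : gauss_cdf s ((2 * x - w ^+ 8 - w) / den w) <=
      gauss_cdf s (a n * (2 * k%:R - 1 - w ^- 7)) by lra.
  apply: gauss_cdf_ndecr.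
  have -> : (2 * x - w ^+ 8 - w) / den w = a n * (2 * (x * w ^- 8) - 1 - w ^- 7).
    by rewrite anE; field; rewrite wn0 gt_eqF.
  by rewrite ler_pM2l // !lerD2r ler_pM2l.
Qed.

Let gauss_continuous : continuous (gauss_cdf s).
Proof.
move=> y; apply/differentiable_continuous/derivable1_diffP.
by have [] := is_derive_gauss_cdf s y s_neq0.
Qed.

Let cvg_exprn0 (m : nat) : root16 n ^+ m.+1 @[n --> \oo] --> (0 : R).
Proof.
rewrite -[X in _ --> X](expr0n R m.+1).
exact: (continuous_cvg _ (@exprn_continuous _ m.+1 0) cvg_root16).
Qed.

Let cvg_remainder : remainder (root16 n) @[n --> \oo] --> (0 : R).
Proof.
have w_inv : (root16 n)^-1 @[n --> \oo] --> +oo.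
  apply/cvgrVy; last exact: cvg_root16.
  by exists 1%N => // n /= n0; exact: root16_gt0.
have -> : (0 : R) = 2 * (1 - 1) + 2 * D * 0 by ring.
apply: cvgD; apply: cvgM.
- exact: cvg_cst.
- apply: cvgB; first exact: cvg_cst.
  exact: (cvg_comp _ _ w_inv (cvg_gauss_cdfy s)).
- exact: cvg_cst.
- exact: cvg_exprn0.
Qed.

Let cvg_main (c d : R) :
  2 * (1 - gauss_cdf s ((2 * x + c * root16 n ^+ 8 + d * root16 n) / den (root16 n)))
    @[n --> \oo] --> 2 * (1 - gauss_cdf s x).
Proof.
apply: cvgM; first exact: cvg_cst.
apply: cvgB; first exact: cvg_cst.
apply: (continuous_cvg _ (gauss_continuous x)).
have den0 : den 0 = 2.
  rewrite /den expr0n add0r (_ : 4 = 2 ^+ 2 :> R); last by ring.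
  by rewrite sqrtr_sqr ger0_norm.
have xE : (2 * x + c * 0 + d * 0) / den 0 = x by rewrite den0; field.
rewrite -[X in _ --> X]xE.
apply: cvgM.
  apply: cvgD; last by apply: cvgM; [exact: cvg_cst|exact: cvg_root16].
  apply: cvgD; first exact: cvg_cst.
  by apply: cvgM; [exact: cvg_cst|exact: cvg_exprn0].
apply: cvgV; first by rewrite den0.
apply: (continuous_cvg _ (@sqrt_continuous R _)).
rewrite expr0n; apply: cvgD; last exact: cvg_cst.
exact: cvg_exprn0.
Qed.

(** At time [w ^- 12 + 4 * n] the length scale is [2 * sqrt n] to the first
    order, while [2 * k] is close to [2 * x * sqrt n]. *)
Lemma critical_average_cvg (u : nat -> R^nat) :
  (forall k, u k.+1 0%N = 0) ->
  (forall k m, u k.+1 m.+1 =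
    (1 - 2 * q) * u k.+1 m + 2 * q * hit q (1 - 2 * q) q m k.+1.*2) ->
  u (Num.truncn (x * Num.sqrt n%:R)).+1 n @[n --> \oo] --> 2 * (1 - gauss_cdf s x).
Proof.
move=> u0 uS.
apply: (@squeeze_cvgr _ _ _ _ (fun n => low (root16 n)) (fun n => up (root16 n))).
- exists 1%N => // n /= n0; exact: sandwich.
- rewrite -[X in _ --> X]subr0; apply: cvgB; last exact: cvg_remainder.
  by have := cvg_main 3 1; under eq_fun do rewrite mul1r.
- rewrite -[X in _ --> X]addr0; apply: cvgD; last exact: cvg_remainder.
  have := cvg_main (-1) (-1).
  by under eq_fun do rewrite !mulN1r.
Qed.

End critical.

(** * Distribution functions and the limit laws *)

Section step_polynomial_derivatives.
Context {R : realType}.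
Variables pm1 p0 p1 : R.
Local Notation P := (step_polynomial pm1 p0 p1).

Lemma is_derive_step_polynomial (u : R) : u != 0 ->
  is_derive u 1 P (p1 - pm1 * u ^- 2).
Proof.
move=> u0; rewrite /step_polynomial.
have dV : is_derive u 1 (fun v : R => v^-1) (- u ^- 2).
  have := is_deriveV (f := id) u0 (is_derive_id u 1).
  by rewrite /GRing.scale /= mulr1.
apply: is_derive_eq.
by rewrite /GRing.scale /=; ring.
Qed.

Lemma derive1_step_polynomial (u : R) : u != 0 ->
  P^`()%classic u = p1 - pm1 * u ^- 2.
Proof.
move=> u0; rewrite derive1E.
by have [] := is_derive_step_polynomial u u0.
Qed.

(** The formula for the derivative holds only away from 0, which suffices
    because a second derivative is local. *)
Lemma derive1n2_step_polynomial1 : P^`(2)%classic 1 = 2 * pm1.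
Proof.
rewrite derive1nS derive1n1 derive1E.
have d : is_derive (1 : R) 1 (fun u => p1 - pm1 * u ^- 2) (2 * pm1).
  have dX : is_derive (1 : R) 1 (fun v : R => v ^+ 2) 2.
    by apply: is_derive_eq; rewrite /GRing.scale /=; ring.
  have e2 : (1 : R) ^+ 2 != 0 by rewrite expr1n oner_neq0.
  have dV := @is_deriveV R (fun v => v ^+ 2) 1 2 1 e2 dX.
  apply: is_derive_eq.
  by rewrite /GRing.scale /= !expr1n invr1; ring.
suff [] : is_derive (1 : R) 1 (P^`()%classic) (2 * pm1) by [].
apply: near_eq_is_derive d; near=> u; rewrite derive1_step_polynomial //.
rewrite gt_eqF //; near: u; exact: lt_nbhsr.
Unshelve. all: by end_near. Qed.

End step_polynomial_derivatives.

Section limit_laws.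
Context {R : realType}.
Variables (pm1 p0 p1 : {posnum R}).

Lemma cdf_sign_changes (n : nat) (x : R) : 0 <= x ->
  cdf (sign_changes R n : {RV (motzkin_prob pm1 p0 p1 n) >-> R}) x =
  (1 - tail_prob pm1 p0 p1 n (Num.truncn x).+1 (0, 0))%:E.
Proof.
move=> x0; apply: motzkin_prob_tail => w /=.
by rewrite in_itv /= /sign_changes ltnS truncn_ge_nat.
Qed.

Lemma cdf_scaled_sign_changes (n : nat) (x : R) : 0 <= x -> (0 < n)%N ->
  cdf (scaled_sign_changes R n : {RV (motzkin_prob pm1 p0 p1 n) >-> R}) x =
  (1 - tail_prob pm1 p0 p1 n (Num.truncn (x * Num.sqrt n%:R)).+1 (0, 0))%:E.
Proof.
move=> x0 n0; apply: motzkin_prob_tail => w /=.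
rewrite in_itv /= /scaled_sign_changes /sign_changes.
rewrite ler_pdivrMr ?sqrtr_gt0 ?ltr0n //.
by rewrite ltnS truncn_ge_nat // mulr_ge0 ?sqrtr_ge0.
Qed.

Lemma cdf_lt0 d (T : measurableType d) (P : probability T R) (X : {RV P >-> R}) (x : R) :
  (forall t, 0 <= X t) -> x < 0 -> cdf X x = 0%E.
Proof.
move=> X0 x0; rewrite /cdf /distribution /pushforward /=.
rewrite (_ : _ @^-1` _ = set0) ?measure0 // -subset0 => t /=.
by rewrite in_itv /= leNgt (lt_le_trans x0).
Qed.

Lemma sign_changes_cvg_geometric (l : R) : 0 <= l < 1 ->
  (forall k, tail_prob pm1 p0 p1 n k (0, 0) @[n --> \oo] --> l ^+ k) ->
  cvg_in_distribution (fun n => motzkin_prob pm1 p0 p1 n)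
    (fun n => sign_changes R n) (Geom l).
Proof.
move=> l01 tail_l; rewrite /cvg_in_distribution => x _; have [x0|x0] := ltP x 0.
  rewrite Geom_lt0 //; under eq_fun do rewrite cdf_lt0 //.
  exact: cvg_cst.
rewrite Geom_le //; under eq_fun do rewrite cdf_sign_changes //.
apply: cvg_EFin; first exact: nearW.
by apply: cvgB; [exact: cvg_cst|exact: tail_l].
Qed.

Lemma scaled_sign_changes_cvg_half_normal : pm1%:num = p1%:num :> R ->
  cvg_in_distribution (fun n => motzkin_prob pm1 p0 p1 n)
    (fun n => scaled_sign_changes R n)
    (HalfNormal (Num.sqrt (p1%:num / total_weight pm1 p0 p1 / 2))).
Proof.
move=> pE; set Z := total_weight _ _ _; set q := p1%:num / Z.
have Z0 : 0 < Z by exact: total_weight_gt0.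
have q0 : 0 < q by exact: divr_gt0.
have q2 : p0%:num / Z = 1 - 2 * q.
  by have := sum_step_prob pm1 p0 p1; rewrite pE -/Z -/q; lra.
have q2_le : 2 * q <= 1 by rewrite -subr_ge0 -q2 divr_ge0 // ltW.
set s := Num.sqrt _; have s0 : 0 < s by rewrite sqrtr_gt0 divr_gt0.
have sE : s ^+ 2 = q / 2 by rewrite sqr_sqrtr // divr_ge0 // ltW.
rewrite /cvg_in_distribution => x _; have [x0|x0] := ltP x 0.
  rewrite half_normal_lt0 //.
  have X0 n (w : motzkin_walk n) : 0 <= scaled_sign_changes R n w.
    by rewrite divr_ge0 ?sqrtr_ge0 ?ler0n.
  under eq_fun => n do rewrite (cdf_lt0 _ _ _ _ x (X0 n) x0).
  exact: cvg_cst.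
rewrite half_normal_le //.
have tail_cvg : tail_prob pm1 p0 p1 n (Num.truncn (x * Num.sqrt n%:R)).+1 (0, 0)
    @[n --> \oo] --> 2 * (1 - gauss_cdf s x).
  apply: (critical_average_cvg q s q0 q2_le s0 sE x x0
    (fun k n => tail_prob pm1 p0 p1 n k (0, 0))) => [k|k m].
    exact: tail_prob0S.
  rewrite tail_prob_start pE divff ?gt_eqF // expr1n mul1r q2.
  by rewrite opprB addrCA subrr addr0.
have -> : 2 * gauss_cdf s x - 1 = 1 - 2 * (1 - gauss_cdf s x) by ring.
apply: (@cvg_trans _ ((fun n => (1 - tail_prob pm1 p0 p1 n
    (Num.truncn (x * Num.sqrt n%:R)).+1 (0, 0))%:E) @ \oo)).
  apply: near_eq_cvg; exists 1%N => // n n0.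
  by apply/esym; exact: cdf_scaled_sign_changes.
apply: cvg_EFin; first exact: nearW.
by apply: cvgB; [exact: cvg_cst|exact: tail_cvg].
Qed.

End limit_laws.

Theorem theorem3p17 (R : realType) (pm1 p0 p1 : {posnum R}) :
  let P : R -> R := step_polynomial pm1%:num p0%:num p1%:num in
  let delta : R := (P^`()%classic) 1 in
  let lambda : R :=
    if delta < 0 then p1%:num / pm1%:num else pm1%:num / p1%:num in
  (delta != 0 ->
    cvg_in_distribution (fun n => motzkin_prob pm1 p0 p1 n)
      (fun n => sign_changes R n)
      (Geom lambda)) /\
  (delta = 0 ->
    cvg_in_distribution (fun n => motzkin_prob pm1 p0 p1 n)
      (fun n => scaled_sign_changes R n)
      (HalfNormal (1 / 2 * Num.sqrt ((P^`(2)%classic) 1 / P 1)))).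
Proof.
move=> P delta lambda.
have deltaE : delta = p1%:num - pm1%:num.
  by rewrite /delta derive1_step_polynomial ?oner_neq0 // expr1n invr1 mulr1.
rewrite {}/lambda deltaE subr_lt0 subr_eq0; split => [p_neq|/subr0_eq pE].
- have [lt_p|lt_p|/eqP] := ltgtP p1%:num pm1%:num; last by rewrite (negbTE p_neq).
  + apply: sign_changes_cvg_geometric => [|k].
      by rewrite divr_ge0 // ltr_pdivrMr // mul1r.
    exact: cvg_tail_prob_down.
  + apply: sign_changes_cvg_geometric => [|k].
      by rewrite divr_ge0 // ltr_pdivrMr // mul1r.
    exact: cvg_tail_prob_up.
- have -> : 1 / 2 * Num.sqrt (P^`(2)%classic 1 / P 1) =
      Num.sqrt (p1%:num / total_weight pm1 p0 p1 / 2).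
    rewrite derive1n2_step_polynomial1 -pE.
    have -> : P 1 = total_weight pm1 p0 p1.
      by rewrite /P /step_polynomial divr1 mulr1.
    rewrite -[1 / 2](@ger0_norm R) // -sqrtr_sqr -sqrtrM ?sqr_ge0 //.
    by congr Num.sqrt; field; rewrite gt_eqF // total_weight_gt0.
  by apply: scaled_sign_changes_cvg_half_normal.
Qed.
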